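(* Let $T\ge 2$ be an integer and let $\mu>0$, $\sigma>0$, $-\frac{1}{T-1}<\rho<1$ satisfy $\mu^2+\rho\sigma^2>0$. Let $\gamma>0$ and let $$\mathrm{R}(\gamma)=\sup_{\mathbb P\in\mathcal P}\mathbb P\Big(\prod_{t=1}^T\tilde\xi_t\ge\gamma\Big),$$ with the ambiguity set $\mathcal P$ defined in the context. If $T\ge 3$, then $\mathrm{R}(\gamma)$ coincides with the optimal objective value of the following semidefinite program: $$ \begin{aligned} \inf\ \ & \alpha + T\mu\beta + T(\mu^2+\sigma^2)\gamma_1 + T\left(T\mu^2+\sigma^2+(T-1)\rho\sigma^2\right)\gamma_2\\ \text{s.t.}\ \ & \alpha,\beta,\gamma_1,\gamma_2\in\mathbb R,\ \lambda_1,\lambda_2,\lambda_3\ge 0,\ \boldsymbol p\in\mathbb R^{2T+1},\ \boldsymbol P\in\mathbb S^{T+1}_+,\ \boldsymbol q\in\mathbb R^{2T-1},\ \boldsymbol Q\in\mathbb S^{T}_+\\ & \alpha\ge 0,\quad \alpha\ge 1-\lambda_3T\gamma^{1/T},\quad \gamma_1+T\gamma_2\ge 0,\quad \gamma_1+\gamma_2\ge 0\\ & \gamma_2+\tfrac{\gamma_1}{T}+\alpha\ \ge\ \left\Vert\left(\beta-\lambda_1,\ \gamma_2+\tfrac{\gamma_1}{T}-\alpha\right)\right\Vert_2\\ & \gamma_2+\gamma_1+\alpha\ \ge\ \left\Vert\left(\beta-\lambda_2,\ \gamma_2+\gamma_1-\alpha\right)\right\Vert_2\\ & \gamma_2+\tfrac{\gamma_1}{T}+\lambda_3T\gamma^{1/T}+\alpha-1\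 \ge\ \left\Vert\left(\beta-\lambda_3,\ \gamma_2+\tfrac{\gamma_1}{T}-\lambda_3T\gamma^{1/T}-\alpha+1\right)\right\Vert_2\\ & p_0=(T-1)\gamma_1\gamma^{\frac{2}{T-1}}+(T-1)^2\gamma_2\gamma^{\frac{2}{T-1}},\quad p_1+q_0=(T-1)\beta\gamma^{\frac{1}{T-1}}\\ & p_2+q_1=\alpha-1,\quad p_T+q_{T-1}=2(T-1)\gamma_2\gamma^{\frac{1}{T-1}},\quad p_{T+1}+q_T=\beta\\ & p_{2T}=\gamma_1+\gamma_2,\quad p_t+q_{t-1}=0\quad\forall t=3,\dots,T-1,\,T+2,\dots,2T-1\\ & p_t=\textstyle\sum_{i+j=t}P_{i,j}\quad\forall t=0,\dots,2T,\qquad q_t=\sum_{i+j=t}Q_{i,j}\quad\forall t=0,\dots,2T-2. \end{aligned} $$ If $T=2$, then $\mathrm{R}(\gamma)$ is given by the optimal objective value of the variant of this program in which the two constraints $p_2+q_1=\alpha-1$ and $p_T+q_{T-1}=2(T-1)\gamma_2\gamma^{\frac{1}{T-1}}$ are combined into the single constraint $p_2+q_1=\alpha-1+2(T-1)\gamma_2\gamma^{\frac{1}{T-1}}$.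
   Context: $\mathbb S^n$ is the space of symmetric real $n\times n$ matrices and $\mathbb S^n_+$ its subset of positive semidefinite matrices. The entries of $\boldsymbol p,\boldsymbol P,\boldsymbol q,\boldsymbol Q$ are numbered starting from $0$. Here $\gamma$ is a fixed number, whereas $\gamma_1,\gamma_2$ are decision variables. Let $\boldsymbol\mu=\mu\boldsymbol 1\in\mathbb R^T$ and $\boldsymbol\Sigma=(1-\rho)\sigma^2\mathbb I+\rho\sigma^2\boldsymbol 1\boldsymbol 1^\intercal\in\mathbb S^T$ (all variances equal $\sigma^2$, all pairwise correlations equal $\rho$), where $\mathbb I$ is the identity matrix and $\boldsymbol 1$ the all-ones vector. $\mathcal P$ is the set of all Borel probability distributions $\mathbb P$ of a random vector $\tilde{\boldsymbol\xi}=(\tilde\xi_1,\dots,\tilde\xi_T)^\intercal$ supported on $\mathbb R^T_+$ with $\mathbb E_{\mathbb P}(\tilde{\boldsymbol\xi})=\boldsymbol\mu$ and $\mathbb E_{\mathbb P}(\tilde{\boldsymbol\xi}\tilde{\boldsymbol\xi}^\intercal)=\boldsymbol\Sigma+\boldsymbol\mu\boldsymbol\mu^\intercal$. *)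

(* Defs.v *)
From mathcomp Require Import all_boot all_order all_algebra.
From mathcomp Require Import all_classical all_reals all_analysis.

Set Implicit Arguments.
Unset Strict Implicit.
Unset Printing Implicit Defensive.

Import Order.TTheory GRing.Theory Num.Theory.
Import numFieldNormedType.Exports.

Local Open Scope classical_set_scope.
Local Open Scope ring_scope.

(* R^T with its Borel sigma-algebra, i.e. the one generated by the open sets *)
Definition borel_cV (R : realType) (T : nat) :=
  g_sigma_algebraType [set U : set 'cV[R]_T | open U].

Definition mean_vec (R : realType) (T : nat) (mu : R) : 'cV[R]_T :=
  const_mx mu.

Definition cov_mx (R : realType) (T : nat) (sigma rho : R) : 'M[R]_T :=
  ((1 - rho) * sigma ^+ 2)%:M +
  (rho * sigma ^+ 2) *: ((const_mx 1 : 'cV[R]_T) *m (const_mx 1 : 'cV[R]_T)^T).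

(* The moment conditions are componentwise.  The expectation is \bar R-valued
   and is finite only for an integrable random variable, so integrability of
   the components and of their products is part of the conditions. *)
Definition ambiguity_set (R : realType) (T : nat) (mu sigma rho : R) :
    set (probability (borel_cV R T) R) :=
  [set Pr : probability (borel_cV R T) R |
    [/\ Pr [set x : 'cV[R]_T | forall t : 'I_T, 0 <= x t 0] = 1%E,
        forall t : 'I_T,
          'E_Pr[(fun x : 'cV[R]_T => (x t 0)%R)]%E = (mean_vec T mu t 0)%:E
      & forall s t : 'I_T,
          'E_Pr[(fun x : 'cV[R]_T => ((x *m x^T) s t)%R)]%E =
          ((cov_mx T sigma rho + mean_vec T mu *m (mean_vec T mu)^T) s t)%:E]].

Definition worst_case_prob (R : realType) (T : nat) (mu sigma rho gamma : R) :
    \bar R :=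
  ereal_sup [set Pr [set x : 'cV[R]_T | gamma <= \prod_(t < T) x t 0] |
    Pr in @ambiguity_set R T mu sigma rho].

Definition psdmx (R : realType) (n : nat) (A : 'M[R]_n) : Prop :=
  A^T = A /\ forall v : 'cV[R]_n, 0 <= (v^T *m A *m v) 0 0.

Definition norm2 (R : realType) (a b : R) : R := Num.sqrt (a ^+ 2 + b ^+ 2).

Record sdp_vars (R : realType) (T : nat) : Type := SdpVars {
  alpha : R;
  beta : R;
  gamma1 : R;
  gamma2 : R;
  lambda1 : R;
  lambda2 : R;
  lambda3 : R;
  pvec : (2 * T + 1).-tuple R;
  Pmx : 'M[R]_(T + 1);
  qvec : (2 * T - 1).-tuple R;
  Qmx : 'M[R]_T
}.

Definition sdp_objective (R : realType) (T : nat) (mu sigma rho : R)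
    (v : sdp_vars R T) : R :=
  let n : R := T%:R in
  alpha v + n * mu * beta v + n * (mu ^+ 2 + sigma ^+ 2) * gamma1 v +
  n * (n * mu ^+ 2 + sigma ^+ 2 + (n - 1) * rho * sigma ^+ 2) * gamma2 v.

Definition sdp_conic_constraints (R : realType) (T : nat) (gamma : R)
    (v : sdp_vars R T) : Prop :=
  let n : R := T%:R in
  let a := alpha v in let b := beta v in
  let g1 := gamma1 v in let g2 := gamma2 v in
  let l1 := lambda1 v in let l2 := lambda2 v in let l3 := lambda3 v in
  let c := gamma `^ (1 / n) in
  [/\ [/\ 0 <= l1, 0 <= l2, 0 <= l3, psdmx (Pmx v) & psdmx (Qmx v)],
      [/\ 0 <= a, 1 - l3 * n * c <= a, 0 <= g1 + n * g2 & 0 <= g1 + g2],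
      norm2 (b - l1) (g2 + g1 / n - a) <= g2 + g1 / n + a,
      norm2 (b - l2) (g2 + g1 - a) <= g2 + g1 + a
    & norm2 (b - l3) (g2 + g1 / n - l3 * n * c - a + 1)
        <= g2 + g1 / n + l3 * n * c + a - 1].

(* All linear constraints on p, P, q, Q except the ones for (p_2, q_1) and
   (p_T, q_(T-1)), whose form depends on whether T >= 3 or T = 2. *)
Definition sdp_linear_constraints (R : realType) (T : nat) (gamma : R)
    (v : sdp_vars R T) : Prop :=
  let n : R := T%:R in
  let b := beta v in let g1 := gamma1 v in let g2 := gamma2 v in
  let p := pvec v in let q := qvec v in
  [/\ p`_0 = (n - 1) * g1 * gamma `^ (2 / (n - 1)) +
             (n - 1) ^+ 2 * g2 * gamma `^ (2 / (n - 1))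
      /\ p`_1 + q`_0 = (n - 1) * b * gamma `^ (1 / (n - 1)),
      p`_(T + 1) + q`_T = b /\ p`_(2 * T) = g1 + g2,
      forall t : nat,
        (3 <= t <= T - 1)%N || (T + 2 <= t <= 2 * T - 1)%N ->
        p`_t + q`_(t - 1) = 0,
      forall t : nat, (t <= 2 * T)%N ->
        p`_t = \sum_(i < T + 1) \sum_(j < T + 1 | (i + j == t)%N) Pmx v i j
    & forall t : nat, (t <= 2 * T - 2)%N ->
        q`_t = \sum_(i < T) \sum_(j < T | (i + j == t)%N) Qmx v i j].

Definition sdp_feasible (R : realType) (T : nat) (gamma : R)
    (v : sdp_vars R T) : Prop :=
  let n : R := T%:R in
  [/\ sdp_conic_constraints gamma v,
      sdp_linear_constraints gamma v,
      (pvec v)`_2 + (qvec v)`_1 = alpha v - 1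
    & (pvec v)`_T + (qvec v)`_(T - 1) =
        2 * (n - 1) * gamma2 v * gamma `^ (1 / (n - 1))].

(* For T = 2 the last two equations concern the same left-hand side and are
   replaced by a single one. *)
Definition sdp_feasible_merged (R : realType) (T : nat) (gamma : R)
    (v : sdp_vars R T) : Prop :=
  let n : R := T%:R in
  [/\ sdp_conic_constraints gamma v,
      sdp_linear_constraints gamma v
    & (pvec v)`_2 + (qvec v)`_1 =
        alpha v - 1 + 2 * (n - 1) * gamma2 v * gamma `^ (1 / (n - 1))].

Definition sdp_value (R : realType) (T : nat) (mu sigma rho : R)
    (feasible : sdp_vars R T -> Prop) : \bar R :=
  ereal_inf [set (sdp_objective mu sigma rho v)%:E |
    v in [set v : sdp_vars R T | feasible v]].

(* Main.v *)
(* Averaging over permutations, an optimal dual certificate of the moment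
   problem may be taken as the symmetric quadratic
   a + b S(x) + g1 |x|^2 + g2 S(x)^2 with S(x) the coordinate sum, to be
   nonnegative on the orthant and at least 1 where the product is at least gamma.
   For fixed S, the squared norm ranges over [S^2/T, S^2], which turns the first
   requirement (and the second one when g1 >= 0, by AM-GM) into one-variable
   quadratic inequalities, i.e. second-order cone constraints.  When g1 < 0 the
   largest |x|^2 for fixed S and product >= gamma occurs at (y, ..., y, z) with
   y^(T-1) z = gamma; with y = gamma^(1/(T-1)) / w this is nonnegativity on the
   half-line of a polynomial of degree 2T in w, i.e. a sum of squares plus w times
   a sum of squares.  There is no duality gap, and the dual value is attained,
   because the hypotheses on mu, sigma, rho put the moments (1, S, |x|^2, S^2) in
   the interior of their moment cone; a primal atomic measure for these four
   moments is symmetrized over permutations to match all the given moments. *)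

Require Import Defs.
From mathcomp Require Import all_boot all_order all_algebra.
From mathcomp Require Import all_classical all_reals all_analysis.
From mathcomp Require Import zify ring lra.
From mathcomp Require Import perm measurable_realfun.
From mathcomp.real_closed Require polyrcf.

Set Implicit Arguments.
Unset Strict Implicit.
Unset Printing Implicit Defensive.

Import Order.TTheory GRing.Theory Num.Theory.
Import numFieldNormedType.Exports.

Local Open Scope classical_set_scope.
Local Open Scope ring_scope.

(** * Quadratics on a half-line *)

(** As (a + c)^2 - (a - c)^2 = 4ac, a second-order cone constraint of this form is a discriminant
    condition on a quadratic. *)
Lemma norm2_leP (R : realType) (a b c : R) :
  reflect (0 <= a + c /\ b ^+ 2 <= 4 * (a * c)) (norm2 b (a - c) <= a + c).
Proof.
have sq0 : 0 <= b ^+ 2 + (a - c) ^+ 2 by rewrite addr_ge0 ?sqr_ge0.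
apply: (iffP idP) => [h|[ac0 h]].
- have ac0 : 0 <= a + c by apply: le_trans h; exact: sqrtr_ge0.
  split=> //; rewrite -(ler_pXn2r (n := 2)) ?nnegrE ?sqrtr_ge0// sqr_sqrtr// in h.
  nra.
- rewrite -(ler_pXn2r (n := 2)) ?nnegrE ?sqrtr_ge0// sqr_sqrtr//; nra.
Qed.

(** The hypotheses force a and c to be nonnegative; for c > 0 the square is completed, and for c = 0
    also b = 0. *)
Lemma quad_ge0 (R : realFieldType) (a b c s : R) :
  0 <= a + c -> b ^+ 2 <= 4 * (a * c) -> 0 <= a + b * s + c * s ^+ 2.
Proof.
move=> ac0 hd.
have ac : 0 <= a * c by have := sqr_ge0 b; lra.
have a0 : 0 <= a by nra.
have c0 : 0 <= c by nra.
have [c1|] := ltP 0 c; last first.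
  move=> c1; have cE : c = 0 by lra.
  move: hd; rewrite cE mulr0 mulr0 => hd.
  have /eqP : b ^+ 2 = 0 by apply/le_anti; rewrite hd sqr_ge0.
  by rewrite sqrf_eq0 => /eqP->; rewrite !mul0r !addr0.
rewrite -(pmulr_rge0 _ (_ : 0 < 4 * c)); last by lra.
have -> : 4 * c * (a + b * s + c * s ^+ 2) =
  (2 * c * s + b) ^+ 2 + (4 * (a * c) - b ^+ 2) by ring.
by rewrite addr_ge0 ?sqr_ge0//; lra.
Qed.

(** Origin of the multipliers: subtracting a suitable l * s with l >= 0 turns nonnegativity on the
    half-line into nonnegativity on the whole line. *)
Lemma quad_slope (R : realType) (a b c : R) :
  (forall s : R, 0 <= s -> 0 <= a + b * s + c * s ^+ 2) ->
  exists l, [/\ 0 <= l, 0 <= a, 0 <= c & (b - l) ^+ 2 <= 4 * (a * c)].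
Proof.
move=> h.
have a0 : 0 <= a by have := h 0 (lexx _); rewrite expr0n/= !mulr0 !addr0.
have c0 : 0 <= c.
  rewrite leNgt; apply/negP => c0.
  (* Here s >= 1 and - c * s > a + |b|, so c * s^2 outweighs a + |b| * s. *)
  pose s := (1 + a + `|b|) / - c + 1.
  have b0 := normr_ge0 b.
  have s0 : 0 < (1 + a + `|b|) / - c by rewrite divr_gt0//; lra.
  have cs : - c * s = 1 + a + `|b| - c
    by rewrite /s mulrDr mulr1 mulrCA divff ?mulr1//; lra.
  have := h s ltac:(rewrite /s; lra).
  have bl := ler_norm b.
  have s1 : 1 <= s by rewrite /s; lra.
  have : b * s <= `|b| * s by rewrite ler_wpM2r//; lra.
  nra.
(* With this l, (b - l)^2 is exactly 4ac. What remains is l >= 0, read off at the vertex when b < 0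
   < c. *)
exists (b + 2 * Num.sqrt (a * c)).
have ac : 0 <= a * c by rewrite mulr_ge0.
have r0 := sqrtr_ge0 (a * c).
have rE := sqr_sqrtr ac.
split=> //; last by nra.
have [b0|b0] := leP 0 b; first by lra.
have [c1|c1] := ltP 0 c; last first.
  have cE : c = 0 by lra.
  (* At this point a + b * s would equal -1, so b < 0 and c = 0 cannot both hold. *)
  have := h ((a + 1) / - b) ltac:(rewrite divr_ge0//; lra).
  rewrite cE mul0r addr0 invrN mulrN mulrN mulrCA divff ?mulr1; last by lra.
  lra.
have := h (- b / (2 * c)) ltac:(rewrite divr_ge0//; lra).
have -> : a + b * (- b / (2 * c)) + c * (- b / (2 * c)) ^+ 2 =
  (4 * (a * c) - b ^+ 2) / (4 * c) by field; lra.
rewrite pmulr_lge0 ?invr_gt0; last by lra.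
move=> hb.
have : (- b) ^+ 2 <= (2 * Num.sqrt (a * c)) ^+ 2 by lra.
rewrite ler_pXn2r ?nnegrE//; [move=> ?|]; lra.
Qed.

(** The half-line case is applied in u = s - s0; the discriminant does not change under
    translation. *)
Lemma quad_slope_from (R : realType) (a b c s0 : R) : 0 <= s0 ->
  (forall s : R, s0 <= s -> 0 <= a + b * s + c * s ^+ 2) ->
  exists l, [/\ 0 <= l, 0 <= a + l * s0, 0 <= c &
    (b - l) ^+ 2 <= 4 * ((a + l * s0) * c)].
Proof.
move=> s00 h.
have [u u0|l [l0 a0 c0 hl]] :=
    @quad_slope R (a + b * s0 + c * s0 ^+ 2) (b + 2 * c * s0) c.
  have := h (s0 + u) ltac:(lra).
  by congr (_ <= _); ring.
exists l; split=> //; last by lra.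
(* At u = - s0, that is s = 0, the translated quadratic minus l * u equals a + l * s0. *)
have := @quad_ge0 _ _ _ _ (- s0) (addr_ge0 a0 c0) hl.
by congr (_ <= _); ring.
Qed.

(** * Nonnegative polynomials on a half-line *)

Lemma horner_ge0_limit (R : rcfType) (p : {poly R}) (a : R) :
  (forall e, 0 < e -> exists2 y, `|y - a| < e & 0 <= p.[y]) -> 0 <= p.[a].
Proof.
move=> h; rewrite leNgt; apply/negP => pa.
have pa0 : 0 < - p.[a] by rewrite oppr_gt0.
have [d d0 hd] := polyrcf.poly_cont a p pa0.
have [y /hd + py] := h d d0.
by rewrite ltr_norml => /andP[_]; rewrite ltrBlDr addNr ltNge py.
Qed.

(** A nonconstant polynomial that is nonnegative there tends to +oo; beyond some b it is at least
    its value at 0, so the minimum over [0, b] is global. *)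
Lemma poly_min_half_line (R : realType) (p : {poly R}) :
  (forall x, 0 <= x -> 0 <= p.[x]) ->
  exists2 a, 0 <= a & forall x, 0 <= x -> p.[a] <= p.[x].
Proof.
move=> p0.
have [sp|sp] := ltnP 1 (size p); last first.
  by exists 0 => // x _; rewrite (size1_polyC sp) !hornerC.
have lp : 0 < lead_coef p.
  rewrite lt_neqAle eq_sym lead_coef_eq0 -size_poly_gt0 (ltnW sp)/=.
  rewrite leNgt; apply/negP => lp0.
  have [| |M hM] := @polyrcf.poly_lim_infty _ (- p) 1.
  - by rewrite lead_coefN oppr_gt0.
  - by rewrite size_polyN.
  have := hM (Num.max M 0); rewrite le_max lexx => /(_ isT).
  rewrite hornerN; have := p0 (Num.max M 0).
  by rewrite le_max lexx orbT => /(_ isT); lra.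
have [M hM] := polyrcf.poly_lim_infty p.[0] lp sp.
pose b := Num.max M 0.
have b0 : 0 <= b by rewrite le_max lexx orbT.
have [c] := EVT_min b0 (continuous_subspaceT (@continuous_horner R p)).
rewrite in_itv/= => /andP[c0 cb] hc; exists c => // x x0.
have [xb|xb] := leP x b; first by apply: hc; rewrite in_itv/= x0.
apply: le_trans (hM x _); last by apply: le_trans (ltW xb); rewrite le_max lexx.
by apply: hc; rewrite in_itv/= lexx.
Qed.

Lemma size_mul_linear (R : nzRingType) (f g : {poly R}) (n : nat) :
  (size f <= 2)%N -> (2 * size g <= n)%N -> (2 * size (f * g)%R <= n.+2)%N.
Proof.
have : (size (f * g)%R <= (size f + size g).-1)%N by exact: size_polyMleq.
lia.
Qed.

(* Subtract the minimum over the half-line: the difference is divisible by 'X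
   or by the square of a linear factor, and the quotient is again nonnegative. *)
Lemma nonneg_half_line_sos (R : realType) (n : nat) (p : {poly R}) :
  (size p <= n)%N -> (forall x, 0 <= x -> 0 <= p.[x]) ->
  exists s0 s1 : seq {poly R},
    [/\ p = \sum_(f <- s0) f ^+ 2 + 'X * \sum_(f <- s1) f ^+ 2,
        forall f, f \in s0 -> (2 * size f <= n.+1)%N
      & forall f, f \in s1 -> (2 * size f <= n)%N].
Proof.
elim/ltn_ind: n p => n IH p sp p0.
have [sp1|sp1] := leqP (size p) 1.
  have pE := size1_polyC sp1.
  have pc : 0 <= p`_0 by have := p0 0 (lexx _); rewrite {1}pE hornerC.
  have [p00|p00] := eqVneq p`_0 0.
    by exists [::], [::]; split=> //; rewrite !big_nil mulr0 addr0 pE p00.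
  have n0 : (0 < n)%N.
    by apply: leq_trans sp; rewrite pE size_polyC p00.
  exists [:: (Num.sqrt p`_0)%:P], [::]; split=> //.
    by rewrite big_seq1 big_nil mulr0 addr0 -polyC_exp sqr_sqrtr.
  by move=> f; rewrite inE => /eqP->; rewrite size_polyC; case: eqP; lia.
have [a a0 ha] := poly_min_half_line p0.
have pa0 := p0 _ a0.
pose q := p - p.[a]%:P.
have pE : p = p.[a]%:P + q by rewrite /q addrCA subrr addr0.
have sq : size q = size p.
  by rewrite size_polyDl// size_polyN (leq_ltn_trans (size_polyC_leq1 _)).
have q0 x : 0 <= x -> 0 <= q.[x] by move=> /ha; rewrite !hornerE subr_ge0.
have /factor_theorem[r qE] : root q a by rewrite /root !hornerE subrr.
have qn0 : q != 0 by rewrite -size_poly_gt0 sq (ltnW sp1).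
have rn0 : r != 0 by apply: contraNneq qn0 => r0; rewrite qE r0 mul0r.
have sr : (size r).+1 = size p
  by rewrite -sq qE size_Mmonic ?monicXsubC// size_XsubC addn2.
have ge0_right (u : {poly R}) : (forall x, a < x -> 0 <= u.[x]) -> 0 <= u.[a].
  move=> hu; apply: horner_ge0_limit => e e0; exists (a + e / 2).
    by rewrite addrC addKr gtr0_norm ?divr_gt0//; lra.
  by apply: hu; lra.
have r_right x : a < x -> 0 <= r.[x].
  move=> ax; have := q0 x ltac:(lra).
  by rewrite qE hornerM hornerXsubC pmulr_lge0// subr_gt0.
have ra : 0 <= r.[a] by exact: ge0_right.
have [aE|a1] := eqVneq a 0.
  have r0 x : 0 <= x -> 0 <= r.[x].
    by rewrite le_eqVlt => /predU1P[<-|x0];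
      [rewrite -[X in r.[X]]aE|apply: r_right; rewrite aE].
  have n1 : (0 < n)%N by rewrite (leq_trans _ sp)// (ltn_trans _ sp1).
  have srn : (size r <= n.-1)%N.
    by rewrite -ltnS prednK ?sr// (leq_trans _ sp)// (ltn_trans _ sp1).
  have [s0 [s1 [rE h0 h1]]] := IH n.-1 ltac:(lia) r srn r0.
  (* The factor 'X exchanges the two families: 'X * (A + 'X * B) = 'X^2 * B + 'X * A. *)
  exists ((Num.sqrt p.[a])%:P :: [seq 'X * f | f <- s1]), s0; split.
  - rewrite big_cons big_map -polyC_exp sqr_sqrtr//.
    under eq_bigr do rewrite exprMn.
    rewrite -mulr_sumr.
    by rewrite [LHS]pE qE {1}rE aE subr0; ring.
  - move=> f; rewrite inE => /predU1P[->|/mapP[g /h1 hg ->]].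
      by rewrite size_polyC; case: eqP; lia.
    have := size_mul_linear (eq_leq (size_polyX R)) hg.
    by case: n {IH sp srn h0 h1 hg} n1 => [|n].
  - by move=> f /h0; lia.
have agt0 : 0 < a by rewrite lt_neqAle eq_sym a1.
(* As q is nonnegative on both sides of the interior point a, r is nonnegative to the right of a and
   nonpositive to its left; so a is a double root of q. *)
have ra0 : r.[a] = 0.
  apply/le_anti; rewrite ra andbT -oppr_ge0 -hornerN.
  apply: horner_ge0_limit => e e0; exists (a - Num.min a (e / 2)).
    rewrite addrC addKr normrN gtr0_norm ?lt_min ?gt_min ?agt0/= ?divr_gt0//.
    by apply/orP; right; lra.
  set m := Num.min _ _.
  have m0 : 0 < m by rewrite /m lt_min agt0 divr_gt0.
  have ma : m <= a by rewrite /m ge_min lexx.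
  have := q0 (a - m) ltac:(lra).
  rewrite qE hornerM hornerXsubC hornerN; nra.
have /factor_theorem[t rE] : root r a by rewrite /root ra0.
have tn0 : t != 0 by apply: contraNneq rn0 => t0; rewrite rE t0 mul0r.
have st : (size t).+1 = size r
  by rewrite rE size_Mmonic ?monicXsubC// size_XsubC addn2.
have qtE : q = ('X - a%:P) ^+ 2 * t by rewrite qE rE; ring.
have t_ne x : 0 <= x -> x != a -> 0 <= t.[x].
  move=> x0 xa; have := q0 x x0; rewrite qtE hornerM horner_exp hornerXsubC.
  by rewrite pmulr_rge0// exprn_even_gt0//= subr_eq0.
have t0 x : 0 <= x -> 0 <= t.[x].
  move=> x0; have [->|xa] := eqVneq x a; last exact: t_ne.
  by apply: ge0_right => // y ay; apply: t_ne; rewrite ?gt_eqF//; lra.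
have n1 : (1 < n)%N by rewrite (leq_trans sp1).
have stn : (size t <= n.-2)%N.
  by rewrite -2!ltnS st sr; case: n {IH} sp n1 => [|[|n]].
have [s0 [s1 [tE h0 h1]]] := IH n.-2 ltac:(lia) t stn t0.
exists ((Num.sqrt p.[a])%:P :: [seq ('X - a%:P) * f | f <- s0]),
  [seq ('X - a%:P) * f | f <- s1]; split.
- rewrite big_cons !big_map -polyC_exp sqr_sqrtr//.
  under eq_bigr do rewrite exprMn.
  under [X in _ + 'X * X]eq_bigr do rewrite exprMn.
  rewrite -!mulr_sumr.
  by rewrite [LHS]pE qtE {1}tE; ring.
- move=> f; rewrite inE => /predU1P[->|/mapP[g /h0 hg ->]].
    by rewrite size_polyC; case: eqP; lia.
  have := size_mul_linear (eq_leq (size_XsubC a)) hg.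
  by case: n {IH sp stn h0 h1 hg} n1 => [|[|n]].
- move=> f /mapP[g /h1 hg ->].
  have := size_mul_linear (eq_leq (size_XsubC a)) hg.
  by case: n {IH sp stn h0 h1 hg} n1 => [|[|n]].
Qed.

(** * Sum of squares at fixed sum and product *)

(** The feasible vectors form a closed subset of the cube [0, s]^n, nonempty thanks to x, and the
    sum of squares is continuous. *)
Lemma exists_max_sumsq (R : realType) (n : nat) (s gamma : R) (x : 'I_n -> R) :
  (forall i, 0 <= x i) -> \sum_i x i = s -> gamma <= \prod_i x i ->
  exists c : 'I_n -> R,
    [/\ forall i, 0 <= c i, \sum_i c i = s, gamma <= \prod_i c i &
      forall y : 'I_n -> R, (forall i, 0 <= y i) -> \sum_i y i = s ->
        gamma <= \prod_i y i -> \sum_i y i ^+ 2 <= \sum_i c i ^+ 2].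
Proof.
move=> x0 xs xp.
pose K := [set v : 'rV[R]_n | forall i, [set` `[0, s]] (v ord0 i)].
pose sumv (v : 'rV[R]_n) := \sum_i v ord0 i.
pose prodv (v : 'rV[R]_n) := \prod_i v ord0 i.
pose sqv (v : 'rV[R]_n) := \sum_i v ord0 i ^+ 2.
pose A := K `&` (sumv @^-1` [set s] `&` prodv @^-1` [set t | gamma <= t]).
have coordc i : continuous (fun v : 'rV[R]_n => v ord0 i)
  by exact: coord_continuous.
have sumc : continuous sumv.
  by apply: continuous_big => [|i _]; [exact: add_continuous|exact: coordc].
have prodc : continuous prodv.
  by apply: continuous_big => [|i _]; [exact: mul_continuous|exact: coordc].
have cA : compact A.
  apply: compact_closedI; first
    by apply: (@rV_compact R n (fun=> [set` `[0, s]])) => i; exact: segment_compact.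
  apply: closedI; apply: preimage_closed; try exact: closed_ge.
  - by move=> v _; exact: sumc.
  - exact: closed_eq.
  - by move=> v _; exact: prodc.
have sqc : continuous sqv.
  apply: continuous_big => [|i _ v]; first exact: add_continuous.
  by apply: (@continuous_comp _ _ _ _ (fun t : R => t ^+ 2));
    [exact: coordc|exact: exprn_continuous].
have memA (y : 'I_n -> R) : (forall i, 0 <= y i) -> \sum_i y i = s ->
    gamma <= \prod_i y i -> A (\row_i y i).
  move=> y0 ys yp; split; last split.
  - move=> i; rewrite /= mxE in_itv/= y0/= -ys (bigD1 i)//= lerDl.
    by apply: sumr_ge0.
  - by rewrite /= /sumv -ys; apply: eq_bigr => i _; rewrite mxE.
  - rewrite /= /prodv; suff -> : \prod_i (\row_i y i) ord0 i = \prod_i y i by [].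
    by apply: eq_bigr => i _; rewrite mxE.
have [|c] := EVT_max_rV _ cA (continuous_subspaceT sqc).
  by exists (\row_i x i); exact: memA.
rewrite inE => -[cK [cs cp]] cmax; exists (c ord0); split=> //.
  by move=> i; have := cK i; rewrite /= in_itv/= => /andP[].
move=> y y0 ys yp; have := cmax (\row_i y i); rewrite inE => /(_ (memA y y0 ys yp)).
congr (_ <= _); apply: eq_bigr => i _; by rewrite mxE.
Qed.

(** u and v are the roots of X^2 - m X + p. *)
Lemma sqrt_pair (R : rcfType) (m p : R) : 0 <= m -> 0 <= p -> 4 * p <= m ^+ 2 ->
  exists u v, [/\ 0 <= u, 0 <= v, u + v = m & u * v = p].
Proof.
move=> m0 p0 mp; pose r := Num.sqrt (m ^+ 2 - 4 * p).
have r0 : 0 <= r := sqrtr_ge0 _.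
have rE : r ^+ 2 = m ^+ 2 - 4 * p by rewrite sqr_sqrtr// subr_ge0.
have rm : r <= m by rewrite -(ler_pXn2r (n := 2)) ?nnegrE// rE; lra.
by exists ((m - r) / 2), ((m + r) / 2); split; [lra|lra|field|nra].
Qed.

Section max_sumsq.
Variables (R : realType) (n : nat) (gamma : R) (c : 'I_n -> R).
Hypotheses (gamma0 : 0 < gamma) (c0 : forall i, 0 <= c i)
  (cp : gamma <= \prod_i c i)
  (cmax : forall y : 'I_n -> R, (forall i, 0 <= y i) -> \sum_i y i = \sum_i c i ->
        gamma <= \prod_i y i -> \sum_i y i ^+ 2 <= \sum_i c i ^+ 2).

Let cgt0 i : 0 < c i.
Proof.
rewrite lt_neqAle eq_sym c0 andbT; apply/eqP => ci.
by move: cp; rewrite (bigD1 i)//= ci mul0r leNgt gamma0.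
Qed.

(** If the product exceeded gamma, c i and c j could be moved apart at constant sum until it equals
    gamma; this lowers u * v and so raises u^2 + v^2. *)
Lemma max_sumsq_prod (i j : 'I_n) : i != j -> \prod_i c i = gamma.
Proof.
move=> ij; apply/eqP; rewrite eq_le cp andbT leNgt; apply/negP => hlt.
have ji : (j != i) by rewrite eq_sym.
pose r := \prod_(k | (k != i) && (k != j)) c k.
have r0 : 0 < r by rewrite /r; apply: prodr_gt0.
have prodE : \prod_i c i = c i * c j * r.
  by rewrite (bigD1 i)//= (bigD1 j)//= mulrA.
have lt1 : gamma / r < c i * c j by rewrite ltr_pdivrMr// -prodE.
have ci := cgt0 i; have cj := cgt0 j.
have [|||u [v [u0 v0 uv puv]]] := @sqrt_pair _ (c i + c j) (gamma / r).
- by rewrite ltW// addr_gt0.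
- by rewrite ltW// divr_gt0.
- have := sqr_ge0 (c i - c j); nra.
pose y k := if k == i then u else if k == j then v else c k.
have yi : y i = u by rewrite /y eqxx.
have yj : y j = v by rewrite /y (negbTE ji) eqxx.
have yk k : (k != i) && (k != j) -> y k = c k.
  by rewrite /y => /andP[/negbTE-> /negbTE->].
have sumE (f : 'I_n -> R) : \sum_l f l =
    f i + f j + \sum_(l | (l != i) && (l != j)) f l.
  by rewrite (bigD1 i)//= (bigD1 j)//= addrA.
have : \sum_l y l ^+ 2 <= \sum_l c l ^+ 2.
  apply: cmax.
  - by move=> l; rewrite /y; case: eqP => // _; case: eqP.
  - by rewrite !sumE (eq_bigr _ yk) yi yj uv.
  - rewrite (bigD1 i)//= (bigD1 j)//= (eq_bigr _ yk) yi yj -/r.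
    by rewrite mulrA puv divfK ?gt_eqF.
rewrite !sumE (eq_bigr (fun l => c l ^+ 2)); last by move=> l /yk->.
rewrite yi yj lerD2r.
have : (u + v) ^+ 2 = (c i + c j) ^+ 2 by rewrite uv.
nra.
Qed.

(** Otherwise c i < c j <= c k. Coordinate i is raised to the mean a of c i and c j, and coordinates
    j, k are changed so that sum and product are kept; the sum of squares then grows. *)
Lemma max_sumsq_triple (i j k : 'I_n) :
  i != j -> i != k -> j != k -> c j <= c k -> c j <= c i.
Proof.
move=> ij ik jk cjk; rewrite leNgt; apply/negP => cij.
have ji : j != i by rewrite eq_sym.
have ki : k != i by rewrite eq_sym.
have kj : k != j by rewrite eq_sym.
pose r := \prod_(l | (l != i) && (l != j) && (l != k)) c l.
have prodE : \prod_i c i = c i * (c j * (c k * r)).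
  by rewrite (bigD1 i)//= (bigD1 j)//= (bigD1 k)//= ?ki ?kj.
have ci := cgt0 i; have cj := cgt0 j; have ck := cgt0 k.
pose a := (c i + c j) / 2.
have a0 : 0 < a by rewrite /a; lra.
have ab : c i * c j < a ^+ 2 by rewrite /a; nra.
have [|||u [v [u0 v0 uv puv]]] := @sqrt_pair _ (c k + a) (c i * c j * c k / a).
- by lra.
- by apply: divr_ge0; [rewrite !mulr_ge0|exact: ltW].
- have h1 : c i * c j * c k / a <= a * c k.
    by rewrite ler_pdivrMr//; nra.
  have := sqr_ge0 (c k - a); nra.
pose y l := if l == i then a else if l == j then u else if l == k then v else c l.
have yi : y i = a by rewrite /y eqxx.
have yj : y j = u by rewrite /y (negbTE ji) eqxx.
have yk : y k = v by rewrite /y (negbTE ki) (negbTE kj) eqxx.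
have yl l : (l != i) && (l != j) && (l != k) -> y l = c l.
  by rewrite /y => /andP[/andP[/negbTE-> /negbTE->] /negbTE->].
have sumE (f : 'I_n -> R) : \sum_l f l =
    f i + f j + f k + \sum_(l | (l != i) && (l != j) && (l != k)) f l.
  by rewrite (bigD1 i)//= (bigD1 j)//= (bigD1 k)/= ?ki ?kj// !addrA.
have : \sum_l y l ^+ 2 <= \sum_l c l ^+ 2.
  apply: cmax.
  - move=> l; rewrite /y; case: eqP => [_|_]; first exact: ltW.
    by case: eqP => // _; case: eqP.
  - rewrite !sumE (eq_bigr _ yl) yi yj yk; congr (_ + _).
    by rewrite -addrA uv /a; field.
  - rewrite (bigD1 i)//= (bigD1 j)//= (bigD1 k)/= ?ki ?kj// (eq_bigr _ yl) yi yj yk.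
    suff -> : a * (u * (v * r)) = c i * (c j * (c k * r)) by rewrite -prodE.
    by rewrite !mulrA -(mulrA a) puv; field; lra.
rewrite !sumE (eq_bigr (fun l => c l ^+ 2)); last by move=> l /yl->.
rewrite yi yj yk lerD2r.
have : (u + v) ^+ 2 = (c k + a) ^+ 2 by rewrite uv.
have qa : (c i * c j * c k / a) * a = c i * c j * c k by rewrite divfK// gt_eqF.
have : 0 < (a ^+ 2 - c i * c j) * (c k - a) by rewrite mulr_gt0 ?subr_gt0// /a; lra.
(* At fixed sum, the squares grow when the second elementary symmetric function of the three values
   drops; a times that drop is this positive product. *)
have -> : (a ^+ 2 - c i * c j) * (c k - a) =
  a * (c i * c j + 2 * a * c k - a * c k - a ^+ 2 - u * v).
  by rewrite puv; ring: qa.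
rewrite pmulr_rgt0//.
have : (c i + c j) = 2 * a by rewrite /a; field.
nra.
Qed.

End max_sumsq.

(* At a maximizer of the sum of squares, any two coordinates other than the
   largest one must be equal (move the smallest one up, keeping sum and product),
   and the product constraint must be tight. *)
Lemma equal_variable (R : realType) (n : nat) (gamma : R) (x : 'I_n -> R) :
  (2 <= n)%N -> 0 < gamma -> (forall i, 0 <= x i) -> gamma <= \prod_i x i ->
  exists y z : R, [/\ 0 < y, y ^+ n.-1 * z = gamma,
    (n%:R - 1) * y + z = \sum_i x i &
    \sum_i x i ^+ 2 <= (n%:R - 1) * y ^+ 2 + z ^+ 2].
Proof.
move=> n2 g0 x0 xp.
have [c [c0 cs cp]] := exists_max_sumsq x0 erefl xp.
rewrite -cs => cmax.
case: n n2 x x0 xp c c0 cs cp cmax => [|[|n]]// _ x x0 xp c c0 cs cp cmax.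
have [k _ kmax] := @arg_maxP _ R 'I_n.+2 ord0 xpredT c isT.
have [j jk] : exists j, j != k.
  by case: (eqVneq k ord0) => [->|?]; [exists ord_max|exists ord0; rewrite eq_sym].
have cE l : l != k -> c l = c j.
  move=> lk; have [->//|lj] := eqVneq l j.
  by apply/le_anti/andP; split;
    apply: (max_sumsq_triple g0 c0 cp cmax (k := k)) => //; rewrite 1?eq_sym//;
      exact: kmax.
have prE : \prod_i c i = gamma := max_sumsq_prod g0 c0 cp cmax jk.
have cardk : #|[pred l | l != k]| = n.+1
  by rewrite (eq_card (B := predC1 k))// cardC1 card_ord.
have nE : n.+2%:R - 1 = n.+1%:R :> R by rewrite -addn1 natrD addrK.
exists (c j), (c k); rewrite nE; split.
- rewrite lt_neqAle eq_sym c0 andbT; apply/eqP => cj0.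
  by move: g0; rewrite -prE (bigD1 j)//= cj0 mul0r ltxx.
- rewrite -prE [RHS](bigD1 k)//= mulrC; congr (_ * _).
  by rewrite (eq_bigr _ cE) prodr_const cardk.
- rewrite [RHS](bigD1 k)//= addrC; congr (_ + _).
  by rewrite (eq_bigr _ cE) sumr_const cardk -[RHS]mulr_natl.
- apply: le_trans (cmax _ x0 (esym cs) xp) _.
  rewrite (bigD1 k)//= addrC lerD2r (eq_bigr (fun=> c j ^+ 2)); last
    by move=> l /cE->.
  by rewrite sumr_const cardk -[leLHS]mulr_natl.
Qed.

(** * Gram matrices and the linear constraints *)

(** The matrix is the sum of the outer squares of the coefficient vectors. *)
Lemma sos_gram (R : realType) (N : nat) (s : seq {poly R}) :
  (forall f, f \in s -> (size f <= N)%N) ->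
  exists2 G : 'M[R]_N, psdmx G &
    forall t, \sum_(i < N) \sum_(j < N | (i + j == t)%N) G i j =
      (\sum_(f <- s) f ^+ 2)`_t.
Proof.
move=> hs; exists (\matrix_(i, j) \sum_(f <- s) f`_i * f`_j).
  split=> [|v]; first by apply/matrixP => i j; rewrite !mxE;
    apply: eq_bigr => f _; rewrite mulrC.
  have -> : (v^T *m (\matrix_(i, j) \sum_(f <- s) f`_i * f`_j) *m v) 0 0 =
      \sum_(f <- s) (\sum_i v i 0 * f`_i) ^+ 2.
    rewrite mxE; under eq_bigr do rewrite mxE mulr_suml.
    under eq_bigr do under eq_bigr do rewrite !mxE mulr_sumr mulr_suml.
    under eq_bigr do rewrite exchange_big.
    rewrite exchange_big; apply: eq_bigr => f _ /=.
    rewrite expr2 mulr_suml; apply: eq_bigr => i _.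
    by rewrite mulr_sumr; apply: eq_bigr => j _; ring.
  by apply: sumr_ge0 => f _; exact: sqr_ge0.
move=> t; rewrite coef_sum.
under eq_bigr do under eq_bigr do rewrite mxE.
under eq_bigr do rewrite exchange_big.
rewrite exchange_big big_seq [RHS]big_seq; apply: eq_bigr => f /hs sf /=.
have fE : f = \sum_(i < N) f`_i *: 'X^i.
  by rewrite -poly_def; apply/polyP => i; rewrite coef_poly;
    case: ltnP => // /(leq_trans sf) /(nth_default 0).
rewrite [in RHS]fE expr2 mulr_suml coef_sum; apply: eq_bigr => i _.
rewrite mulr_sumr coef_sum big_mkcond; apply: eq_bigr => j _.
rewrite -scalerAl -scalerAr -exprD !coefZ coefXn eq_sym.
by case: eqP; rewrite /= ?mulr1 ?mulr0.
Qed.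

(** With v = (1, w, ..., w^(N-1)) the sum is v^T G v. The bound on 2N keeps every i + j below M, so
    no entry of G is lost. *)
Lemma psd_gram_ge0 (R : realType) (N M : nat) (G : 'M[R]_N) (c : nat -> R) (w : R) :
  (2 * N <= M.+1)%N -> psdmx G ->
  (forall t, (t < M)%N -> c t = \sum_(i < N) \sum_(j < N | (i + j == t)%N) G i j) ->
  0 <= \sum_(t < M) c t * w ^+ t.
Proof.
move=> NM [_ /(_ (\col_i w ^+ i))] hG hc.
suff -> : \sum_(t < M) c t * w ^+ t =
    ((\col_i w ^+ i)^T *m G *m (\col_i w ^+ i)) 0 0 by [].
rewrite mxE; under [RHS]eq_bigr do rewrite [X in X * _]mxE mulr_suml.
rewrite exchange_big/=.
under eq_bigr => t _ do rewrite hc// mulr_suml.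
rewrite exchange_big; apply: eq_bigr => i _ /=.
under eq_bigr do rewrite mulr_suml big_mkcond.
rewrite exchange_big; apply: eq_bigr => j _ /=.
have ijM : (i + j < M)%N by have := ltn_ord i; have := ltn_ord j; lia.
rewrite (bigD1 (Ordinal ijM))//= eqxx big1 => [|t].
  by rewrite !mxE addr0 exprD; ring.
by rewrite -val_eqE/= => /negbTE; rewrite eq_sym => ->.
Qed.

(* Coefficients in [w] of [w ^+ 2 * (f - 1)], where [f] is the symmetric quadratic
   evaluated at T - 1 coordinates gamma^(1/(T-1)) / w and one coordinate w^(T-1). *)
Definition two_value_coef (R : realType) (T : nat) (gamma a b g1 g2 : R)
  (t : nat) : R :=
  let n : R := T%:R in
  ((n - 1) * g1 * gamma `^ (2 / (n - 1)) +
     (n - 1) ^+ 2 * g2 * gamma `^ (2 / (n - 1))) * (t == 0%N)%:R +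
  (n - 1) * b * gamma `^ (1 / (n - 1)) * (t == 1%N)%:R +
  (a - 1) * (t == 2)%:R +
  2 * (n - 1) * g2 * gamma `^ (1 / (n - 1)) * (t == T)%:R +
  b * (t == T.+1)%:R + (g1 + g2) * (t == (2 * T)%N)%:R.

(** Monomials are extracted one at a time, so the coincidence of the exponents 2 and T when T = 2
    needs no separate case. *)
Lemma two_value_coef_sum (R : realType) (T : nat) (gamma a b g1 g2 w : R) :
  let g := gamma `^ (1 / (T%:R - 1)) in
  (2 <= T)%N -> w != 0 ->
  \sum_(t < (2 * T).+1) two_value_coef T gamma a b g1 g2 t * w ^+ t =
  w ^+ 2 * (a - 1 + b * ((T%:R - 1) * (g / w) + w ^+ T.-1) +
    g1 * ((T%:R - 1) * (g / w) ^+ 2 + (w ^+ T.-1) ^+ 2) +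
    g2 * ((T%:R - 1) * (g / w) + w ^+ T.-1) ^+ 2).
Proof.
move=> g T2 w0.
have delta k (c : R) : (k <= 2 * T)%N ->
    \sum_(t < (2 * T).+1) c * (t == k :> nat)%:R * w ^+ t = c * w ^+ k.
  rewrite -ltnS => kT;
    rewrite (bigD1 (Ordinal kT))//= eqxx mulr1 big1 ?addr0// => t.
  by rewrite -val_eqE/= => /negbTE->; rewrite mulr0 mul0r.
have gg : gamma `^ (2 / (T%:R - 1)) = g ^+ 2.
  by rewrite -powR_mulrn ?powR_ge0// -powRrM; congr (_ `^ _); rewrite mulrAC mul1r.
under eq_bigr do rewrite /two_value_coef -/g gg !mulrDl -!mulrDl.
under eq_bigr do rewrite !(mulrDl _ _ (w ^+ _)).
rewrite !big_split/= !delta; try lia.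
case: T T2 @g delta gg => [//|T] T2 g _ _.
have -> : (2 * T.+1 = T + T + 2)%N by lia.
rewrite /= !exprD !exprS expr0.
by field.
Qed.

Ltac decide_nat_eqs :=
  repeat match goal with |- context [@eq_op _ ?i ?j] =>
    first [have -> : (i == j :> nat) = true by lia
          |have -> : (i == j :> nat) = false by lia] end;
  rewrite /= ?(mulr0, addr0, add0r, mulr1).

(** The linear equations together say that p(w) + w q(w) has the coefficients [two_value_coef]. For
    T = 2 the exponents 2 and T collide, which is why two equations merge. *)
Lemma sdp_linear_coef (R : realType) (T : nat) (gamma : R) (v : sdp_vars R T) :
  (2 <= T)%N ->
  (forall t, (t <= 2 * T)%N ->
    (pvec v)`_t + (if t is s.+1 then (qvec v)`_s else 0) =
    two_value_coef T gamma (alpha v) (beta v) (gamma1 v) (gamma2 v) t) <->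
  ([/\ (pvec v)`_0 = (T%:R - 1) * gamma1 v * gamma `^ (2 / (T%:R - 1)) +
             (T%:R - 1) ^+ 2 * gamma2 v * gamma `^ (2 / (T%:R - 1))
      /\ (pvec v)`_1 + (qvec v)`_0 =
        (T%:R - 1) * beta v * gamma `^ (1 / (T%:R - 1)),
      (pvec v)`_(T + 1) + (qvec v)`_T = beta v /\ (pvec v)`_(2 * T) = gamma1 v +
        gamma2 v
    & forall t : nat,
        (3 <= t <= T - 1)%N || (T + 2 <= t <= 2 * T - 1)%N ->
        (pvec v)`_t + (qvec v)`_(t - 1) = 0]
  /\ if (T == 2)%N then (pvec v)`_2 + (qvec v)`_1 =
        alpha v - 1 + 2 * (T%:R - 1) * gamma2 v * gamma `^ (1 / (T%:R - 1))
     else (pvec v)`_2 + (qvec v)`_1 = alpha v - 1 /\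
          (pvec v)`_T + (qvec v)`_(T - 1) =
            2 * (T%:R - 1) * gamma2 v * gamma `^ (1 / (T%:R - 1))).
Proof.
move=> T2.
case: v => a b g1 g2 l1 l2 l3 [p /= _] P [q /= /eqP sq] Q.
have coefE t : two_value_coef T gamma a b g1 g2 t =
  ltac:(let e := eval unfold two_value_coef in
    (two_value_coef T gamma a b g1 g2 t) in exact e) by [].
(* [q] has 2T - 1 entries, so its entry 2T - 1 is the default 0 and only [p] contributes in degree
   2T. *)
have q2T : (if (2 * T)%N is s.+1 then q`_s else 0) = 0.
  have -> : (2 * T = (2 * T - 1).+1)%N by lia.
  by rewrite nth_default// sq.
split=> [h|[[[h0 h1] [hT1 h2T] hz] hx] t].
  split.
    split.
    - split.
        by have := h 0%N isT; rewrite coefE; decide_nat_eqs.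
      by have := h 1%N ltac:(lia); rewrite coefE; decide_nat_eqs.
    - split.
        by have := h T.+1 ltac:(lia); rewrite coefE addn1; decide_nat_eqs.
      have := h (2 * T)%N (leqnn _); rewrite coefE; decide_nat_eqs => <-.
      by rewrite q2T addr0.
    - move=> t ht; have := h t ltac:(lia); rewrite coefE; decide_nat_eqs.
      by case: t ht => [|t] ht; [lia|rewrite subn1].
  case: eqP => [TE|T3].
    by have := h 2 ltac:(lia); rewrite coefE; decide_nat_eqs.
  split.
    by have := h 2 ltac:(lia); rewrite coefE; decide_nat_eqs.
  have := h T ltac:(lia); rewrite coefE; decide_nat_eqs => <-.
  have TE : T = T.-1.+1 by lia.
  by rewrite TE subn1.
move=> tT; rewrite coefE.
have [->|t0] := eqVneq t 0%N; first by decide_nat_eqs.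
have [->|t1] := eqVneq t 1%N; first by decide_nat_eqs.
have [->|t2] := eqVneq t 2%N.
  by move: hx; case: eqP => [TE|TE] hx; decide_nat_eqs; [|case: hx].
have [tE|tT0] := eqVneq t T.
  move: hx; decide_nat_eqs => -[_ <-].
  by rewrite -tE; case: (t) t0 => // m _; rewrite subn1.
have [->|tT1] := eqVneq t T.+1.
  by decide_nat_eqs; rewrite -hT1 addn1.
have [->|t2T] := eqVneq t (2 * T)%N.
  decide_nat_eqs; rewrite -h2T.
  by rewrite q2T addr0.
decide_nat_eqs; rewrite -[RHS](hz t); last by lia.
by case: (t) t0 => // m _; rewrite subn1.
Qed.

(** * Dual feasible quadratics and the semidefinite program *)

Definition moment_poly (R : realType) (T : nat) (a b g1 g2 : R) (x : 'I_T -> R)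
  : R :=
  a + b * (\sum_i x i) + g1 * (\sum_i x i ^+ 2) + g2 * (\sum_i x i) ^+ 2.

Definition dual_feasible (R : realType) (T : nat) (gamma a b g1 g2 : R) : Prop :=
  forall x : 'I_T -> R, (forall i, 0 <= x i) ->
    0 <= moment_poly a b g1 g2 x /\
    (gamma <= \prod_i x i -> 1 <= moment_poly a b g1 g2 x).

(** Both variants under one name, so that the argument runs once for all T >= 2. *)
Definition sdp_feasible_any (R : realType) (T : nat) (gamma : R)
  (v : sdp_vars R T) :=
  if (T == 2)%N then sdp_feasible_merged gamma v else sdp_feasible gamma v.

Lemma powR_inv_expn (R : realType) (n : nat) (gamma : R) :
  (0 < n)%N -> 0 <= gamma -> (gamma `^ (1 / n%:R)) ^+ n = gamma.
Proof.
move=> n0 g0; rewrite -powR_mulrn ?powR_ge0// -powRrM mul1r mulVf ?powRr1//.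
by rewrite pnatr_eq0 -lt0n.
Qed.

Lemma sqr_sum_le (R : realFieldType) (n : nat) (x : 'I_n -> R) : (0 < n)%N ->
  (\sum_i x i) ^+ 2 / n%:R <= \sum_i x i ^+ 2.
Proof.
move=> n0; set S := \sum_i x i.
have nn : n%:R != 0 :> R by rewrite pnatr_eq0 -lt0n.
have : 0 <= \sum_i (x i - S / n%:R) ^+ 2 by apply: sumr_ge0 => i _; exact: sqr_ge0.
under eq_bigr do rewrite sqrrB.
rewrite big_split/= sumrB sumr_const card_ord.
have -> : \sum_(i < n) x i * (S / n%:R) *+ 2 = S * (S / n%:R) *+ 2.
  by rewrite sumrMnl -mulr_suml.
rewrite -mulr_natl => h; rewrite -subr_ge0; apply: le_trans h _.
rewrite le_eqVlt; apply/orP; left; apply/eqP; move: (\sum_i _) => Q.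
by field.
Qed.

Lemma sumsq_le_sqr (R : realFieldType) (n : nat) (x : 'I_n -> R) :
  (forall i, 0 <= x i) -> \sum_i x i ^+ 2 <= (\sum_i x i) ^+ 2.
Proof.
move=> x0; rewrite [leRHS]expr2 mulr_suml; apply: ler_sum => i _.
by rewrite expr2 ler_wpM2l// (bigD1 i)//= lerDl sumr_ge0.
Qed.

Lemma sum_ge_of_prod (R : realType) (n : nat) (gamma : R) (x : 'I_n -> R) :
  (0 < n)%N -> 0 <= gamma -> (forall i, 0 <= x i) -> gamma <= \prod_i x i ->
  n%:R * gamma `^ (1 / n%:R) <= \sum_i x i.
Proof.
move=> n0 g0 x0 xp.
have := leif_AGM (A := predT) (E := x) (fun i _ => x0 i).
rewrite /= cardT size_enum_ord => -[h _].
have S0 : 0 <= (\sum_i x i) / n%:R by rewrite divr_ge0// sumr_ge0.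
have := le_trans xp h; rewrite -{1}(powR_inv_expn n0 g0).
rewrite ler_pXn2r ?nnegrE ?powR_ge0// ler_pdivlMr ?ltr0n//.
by rewrite mulrC.
Qed.

Lemma sdp_feasible_anyP (R : realType) (T : nat) (gamma : R) (v : sdp_vars R T) :
  (2 <= T)%N ->
  sdp_feasible_any gamma v <->
  [/\ sdp_conic_constraints gamma v,
    forall t, (t <= 2 * T)%N ->
      (pvec v)`_t + (if t is s.+1 then (qvec v)`_s else 0) =
      two_value_coef T gamma (alpha v) (beta v) (gamma1 v) (gamma2 v) t,
    forall t : nat, (t <= 2 * T)%N ->
        (pvec v)`_t = \sum_(i < T + 1) \sum_(j < T + 1 | (i + j == t)%N) Pmx v i j
    & forall t : nat, (t <= 2 * T - 2)%N ->
        (qvec v)`_t = \sum_(i < T) \sum_(j < T | (i + j == t)%N) Qmx v i j].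
Proof.
move=> T2; rewrite /sdp_feasible_any; split.
- move=> h; suff [hc [h1 h2 h3 hp hq] hx] : [/\ sdp_conic_constraints gamma v,
    sdp_linear_constraints gamma v & if (T == 2)%N then (pvec v)`_2 + (qvec v)`_1 =
        alpha v - 1 + 2 * (T%:R - 1) * gamma2 v * gamma `^ (1 / (T%:R - 1))
     else (pvec v)`_2 + (qvec v)`_1 = alpha v - 1 /\
          (pvec v)`_T + (qvec v)`_(T - 1) =
            2 * (T%:R - 1) * gamma2 v * gamma `^ (1 / (T%:R - 1))].
    by split=> //; apply/sdp_linear_coef.
  by move: h; case: ifP => _; [case|case].
- case=> hc /sdp_linear_coef -/(_ T2)[[h1 h2 h3] hx] hp hq.
  by move: hx; case: ifP => _; [|case]; split.
Qed.

(** The sum of squares X lies in [S^2 / n, S^2], and the sign of g1 tells which end is the worse.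
    The cone constraints settle the resulting quadratics in S; the Gram matrices serve the case g1 <
    0 with product at least gamma. *)
Lemma sdp_feasible_dual (R : realType) (T : nat) (gamma : R) (v : sdp_vars R T) :
  (2 <= T)%N -> 0 < gamma -> sdp_feasible_any gamma v ->
  dual_feasible T gamma (alpha v) (beta v) (gamma1 v) (gamma2 v).
Proof.
move=> T2 g0.
have T0 : (0 < T)%N := ltnW T2.
have T10 : (0 < T.-1)%N by lia.
move=> /(sdp_feasible_anyP _ _ T2)[].
case: v => a b g1 g2 l1 l2 l3 p P q Q /= [[/= l10 l20 l30 hP hQ]].
move=> [a0 a1 c10 c20].
set n : R := T%:R; set c := gamma `^ (1 / n).
move=> /norm2_leP[h10 h11] /norm2_leP[h20 h21].
have -> : g2 + g1 / n - l3 * n * c - a + 1 = g2 + g1 / n - (l3 * n * c + a - 1)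
  by ring.
have -> : g2 + g1 / n + l3 * n * c + a - 1 = g2 + g1 / n + (l3 * n * c + a - 1)
  by ring.
move=> /norm2_leP[h30 h31] hcoef hp hq x x0.
have n0 : 0 < n by rewrite /n ltr0n.
have S0 : 0 <= \sum_i x i by apply: sumr_ge0.
have := sqr_sum_le x T0; have := sumsq_le_sqr x0.
rewrite /moment_poly -/n.
move: (equal_variable T2 g0 x0) (@sum_ge_of_prod _ _ gamma x T0 (ltW g0) x0).
rewrite -/n -/c.
set S := \sum_i x i in S0 *; set X := \sum_i _ ^+ 2 => hev hAG hX1 hX2.
have hS a' b' c' : 0 <= c' + a' -> b' ^+ 2 <= 4 * (c' * a') ->
    0 <= a' + b' * S + c' * S ^+ 2.
  by move=> ? ?; apply: quad_ge0; [rewrite addrC|rewrite (mulrC a')].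
have := hS _ _ _ h10 h11; have := hS _ _ _ h20 h21.
have := hS _ _ _ h30 h31 => q3 q2 q1.
have l1S : 0 <= l1 * S by rewrite mulr_ge0.
have l2S : 0 <= l2 * S by rewrite mulr_ge0.
have g1X : 0 <= g1 -> g1 / n * S ^+ 2 <= g1 * X.
  by move=> g10; rewrite -mulrA ler_wpM2l// mulrC.
split.
  have [g10|g10] := leP 0 g1.
    have := g1X g10; lra.
  have : g1 * S ^+ 2 <= g1 * X by rewrite ler_wnM2l// ltW.
  lra.
move=> xp.
have [g10|g10] := leP 0 g1.
  have := g1X g10.
  (* By the third quadratic the polynomial minus 1 is at least this term, which is nonnegative by
     AM-GM. *)
  have : 0 <= l3 * (S - n * c) by rewrite mulr_ge0// subr_ge0 hAG.
  lra.
have [y [z [y0 yz yzS yzX]]] := hev xp.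
have nE : T.-1%:R = n - 1 :> R by rewrite -subn1 natrB.
pose g := gamma `^ (1 / (n - 1)).
have gE : g ^+ T.-1 = gamma by rewrite /g -nE powR_inv_expn ?ltW.
have g_0 : 0 < g by rewrite powR_gt0.
(* Solves y = g / w, whence w^(T-1) = gamma / y^(T-1) = z. *)
pose w := g / y.
have w0 : 0 < w by rewrite divr_gt0.
have gw : g / w = y by rewrite /w; field; rewrite !gt_eqF.
have wz : w ^+ T.-1 = z.
  by rewrite /w expr_div_n gE -yz mulrAC divff ?mul1r// expf_neq0// gt_eqF.
have := two_value_coef_sum gamma a b g1 g2 T2 (lt0r_neq0 w0).
rewrite /= -/n -/g gw wz yzS => sumE.
have : 0 <= w ^+ 2 *
  (a - 1 + b * S + g1 * ((n - 1) * y ^+ 2 + z ^+ 2) + g2 * S ^+ 2).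
  rewrite -sumE.
  have -> : \sum_(t < (2 * T).+1) two_value_coef T gamma a b g1 g2 t * w ^+ t =
      \sum_(t < (2 * T).+1) p`_t * w ^+ t + w * \sum_(t < 2 * T) q`_t * w ^+ t.
    rewrite [in RHS]mulr_sumr.
    have -> : \sum_(i < 2 * T) w * (q`_i * w ^+ i) =
       \sum_(t < (2 * T).+1) (if (t : nat) is s.+1 then q`_s else 0) * w ^+ t.
      rewrite big_ord_recl/= mul0r add0r; apply: eq_bigr => i _.
      by rewrite /= exprS mulrCA.
    rewrite -big_split/=; apply: eq_bigr => t _.
    by rewrite -hcoef ?mulrDl// -ltnS.
  rewrite addr_ge0//.
    by apply: (psd_gram_ge0 _ _ hP) => [|t]; [clear; lia|rewrite ltnS; exact: hp].
  apply: mulr_ge0; [exact: ltW|]; apply: (psd_gram_ge0 _ _ hQ) => [|t tT]; first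
    by clear; lia.
  have [tT2|tT2] := leqP t (2 * T - 2); first exact: hq.
  (* Here t = 2T - 1 lies beyond [q]; the default 0 agrees with the empty antidiagonal of [Q]. *)
  rewrite nth_default ?size_tuple; last by clear -tT2 T2; lia.
  rewrite big1// => i _; rewrite big_pred0// => j.
  by apply/eqP; have := ltn_ord i; have := ltn_ord j; clear -tT2; lia.
rewrite pmulr_rge0 ?exprn_gt0// => h.
have : g1 * ((n - 1) * y ^+ 2 + z ^+ 2) <= g1 * X by rewrite ler_wnM2l// ltW.
lra.
Qed.

(** Vectors with T - 1 coordinates y and one coordinate z already yield every constraint of the
    program. *)
Lemma dual_feasible_sdp (R : realType) (T : nat) (gamma a b g1 g2 : R) :
  (2 <= T)%N -> 0 < gamma -> dual_feasible T gamma a b g1 g2 ->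
  exists2 v : sdp_vars R T, sdp_feasible_any gamma v &
    [/\ alpha v = a, beta v = b, gamma1 v = g1 & gamma2 v = g2].
Proof.
move=> T2 g0 hd.
have T0 : (0 < T)%N := ltnW T2.
have T10 : (0 < T.-1)%N by lia.
set n : R := T%:R.
have n0 : 0 < n by rewrite /n ltr0n.
have i0 : 'I_T := Ordinal T0.
have nE : T.-1%:R = n - 1 :> R by rewrite -subn1 natrB.
have sum2 (y z : R) : \sum_(i < T) (if i == i0 then z else y) = (n - 1) * y + z.
  rewrite (bigD1 i0)//= eqxx addrC; congr (_ + _).
  rewrite (eq_bigr (fun=> y)); last by move=> i /negbTE->.
  by rewrite sumr_const cardC1 card_ord -nE mulr_natl.
have sumsq2 (y z : R) : \sum_(i < T) (if i == i0 then z else y) ^+ 2 =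
  (n - 1) * y ^+ 2 + z ^+ 2.
  by rewrite -sum2; apply: eq_bigr => i _; case: ifP.
have prod2 (y z : R) : \prod_(i < T) (if i == i0 then z else y) = y ^+ T.-1 * z.
  rewrite (bigD1 i0)//= eqxx mulrC; congr (_ * _).
  rewrite (eq_bigr (fun=> y)); last by move=> i /negbTE->.
  by rewrite prodr_const cardC1 card_ord.
have hd2 (y z : R) : 0 <= y -> 0 <= z ->
   let L := a + b * ((n - 1) * y + z) + g1 * ((n - 1) * y ^+ 2 + z ^+ 2) +
     g2 * ((n - 1) * y + z) ^+ 2 in 0 <= L /\ (gamma <= y ^+ T.-1 * z -> 1 <= L).
  move=> y0 z0; have := hd (fun i => if i == i0 then z else y).
  by rewrite /moment_poly sum2 sumsq2 prod2; apply => i; case: ifP.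
have eqL s : a + b * ((n - 1) * (s / n) + s / n) +
  g1 * ((n - 1) * (s / n) ^+ 2 + (s / n) ^+ 2) +
     g2 * ((n - 1) * (s / n) + s / n) ^+ 2 = a + b * s + (g2 + g1 / n) * s ^+ 2.
  by field; rewrite gt_eqF.
(* Constant vectors of sum s give the first multiplier; multiples of a unit vector (y = 0, z = s)
   then give the second. *)
have [s s0|l1 [l10 a0 c0 h1]] := @quad_slope R a b (g2 + g1 / n).
  by have [] := hd2 (s / n) (s / n) ltac:(rewrite divr_ge0// ltW)
    ltac:(rewrite divr_ge0// ltW); rewrite eqL.
have [s s0|l2 [l20 _ c1 h2]] := @quad_slope R a b (g2 + g1).
  have [h _] := hd2 0 s (lexx _) s0; apply: le_trans h _.
  by rewrite le_eqVlt; apply/orP; left; apply/eqP; ring.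
pose c := gamma `^ (1 / n).
have c_0 : 0 <= c := powR_ge0 _ _.
(* A constant vector has product at least gamma once its sum is at least n * c. *)
have [|s hs|l3 [l30 a3 _ h3]] := @quad_slope_from R (a - 1) b (g2 + g1 / n) (n * c).
- by rewrite mulr_ge0// ltW.
- have s0 : 0 <= s / n by apply: divr_ge0;
  [apply: le_trans hs; rewrite mulr_ge0// ltW|exact: ltW].
  have [_] := hd2 (s / n) (s / n) s0 s0; rewrite eqL -exprSr prednK// => h.
  have : gamma <= (s / n) ^+ T.
    rewrite -[leLHS](powR_inv_expn T0 (ltW g0)) ler_pXn2r ?nnegrE ?powR_ge0//.
    by rewrite ler_pdivlMr// mulrC.
  by move=> /h; lra.
pose coef := two_value_coef T gamma a b g1 g2.
(* For w > 0, H(w) is w^2 times the dual quadratic minus 1 at y = g / w and z = w^(T-1), where the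
   product is exactly gamma. *)
pose H := \poly_(t < (2 * T).+1) coef t.
have H_pos w : 0 < w -> 0 <= H.[w].
  move=> w0; rewrite horner_poly two_value_coef_sum ?gt_eqF// -/n.
  pose g := gamma `^ (1 / (n - 1)); rewrite -/g.
  rewrite mulr_ge0 ?sqr_ge0//.
  have g_0 : 0 <= g := powR_ge0 _ _.
  have y0 : 0 <= g / w by apply: divr_ge0 => //; exact: ltW.
  have z0 : 0 <= w ^+ T.-1 by apply: exprn_ge0; exact: ltW.
  have [_] := hd2 _ _ y0 z0.
  have gE : g ^+ T.-1 = gamma by rewrite /g -nE powR_inv_expn// ltW.
  rewrite expr_div_n divfK ?gE; last by rewrite expf_neq0// gt_eqF.
  by move=> /(_ (lexx _)); lra.
have H0 w : 0 <= w -> 0 <= H.[w].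
  rewrite le_eqVlt => /predU1P[<-|]; last exact: H_pos.
  apply: horner_ge0_limit => e e0; exists (e / 2); last by apply: H_pos; lra.
  by rewrite subr0 gtr0_norm; lra.
(* As H has size at most 2T + 1, the sizes are at most T + 1 in [s0] and T in [s1], the orders of
   [P] and [Q]. *)
have [s0 [s1 [HE hs0 hs1]]] := nonneg_half_line_sos (size_poly _ _) H0.
have [|P hP PE] := @sos_gram R (T + 1) s0.
  by move=> f /hs0; clear; lia.
have [|Q hQ QE] := @sos_gram R T s1.
  by move=> f /hs1; clear; lia.
pose sp := \sum_(f <- s0) f ^+ 2; pose sq := \sum_(f <- s1) f ^+ 2.
pose p := @Tuple (2 * T + 1) R _
  (introT eqP (size_mkseq (fun i => sp`_i) (2 * T + 1))).
pose q := @Tuple (2 * T - 1) R _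
  (introT eqP (size_mkseq (fun i => sq`_i) (2 * T - 1))).
have pE t : (t <= 2 * T)%N -> p`_t = sp`_t.
  by move=> tT; rewrite /p/= nth_mkseq//; clear -tT; lia.
have qE t : (t < 2 * T - 1)%N -> q`_t = sq`_t.
  by move=> tT; rewrite /q/= nth_mkseq.
exists (SdpVars a b g1 g2 l1 l2 l3 p P q Q) => //.
apply/sdp_feasible_anyP => //; split=> /=.
- rewrite /sdp_conic_constraints/= -/n -/c; split => //.
  + split=> //; [lra| |lra].
    have -> : g1 + n * g2 = n * (g2 + g1 / n) by field; rewrite gt_eqF.
    by rewrite mulr_ge0// ltW.
  + by apply/norm2_leP; split; [lra|rewrite [_ * a]mulrC].
  + by apply/norm2_leP; split; [lra|rewrite [_ * a]mulrC].
  + have -> : g2 + g1 / n - l3 * n * c - a + 1 = g2 +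
    g1 / n - (l3 * n * c + a - 1) by ring.
    have -> : g2 + g1 / n + l3 * n * c + a - 1 = g2 + g1 / n +
      (l3 * n * c + a - 1) by ring.
    by apply/norm2_leP; split; lra.
- move=> t tT; have -> : two_value_coef T gamma a b g1 g2 t = H`_t.
    by rewrite coef_poly ltnS tT.
  rewrite /H HE coefD coefXM -/sp -/sq pE//; congr (_ + _).
  case: t tT => [|t] tT //=.
  have [tT2|tT2] := ltnP t (2 * T - 1); first by rewrite qE.
  rewrite nth_default ?size_mkseq// /sq -QE big1// => i _; rewrite big_pred0// => j.
  by apply/eqP; have := ltn_ord i; have := ltn_ord j; clear -tT2; lia.
- by move=> t tT; rewrite pE// /sp -PE.
- by move=> t tT; rewrite qE; [rewrite /sq -QE|clear -tT T2; lia].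
Qed.

(** * Hahn-Banach and duality for moment problems *)

(** The inequality for positive s gives equality when applied to s^-1 as well. *)
Definition sublinear (R : realType) (V : lmodType R) (p : V -> R) : Prop :=
  (forall u v, p (u + v) <= p u + p v) /\
  (forall s u, 0 < s -> p (s *: u) <= s * p u).

Lemma sublinear0 (R : realType) (V : lmodType R) (p : V -> R) : sublinear p ->
  p 0 = 0.
Proof.
move=> [pD pZ]; have := pD 0 0; rewrite addr0 => h.
by have := pZ 2^-1 0 ltac:(lra); rewrite scaler0 => h2; lra.
Qed.

(** [G u r] means that r is an attainable value at u. This serves both the straightening step of
    Hahn-Banach and the perturbation function of the moment problem. *)
Lemma sublinear_inf (R : realType) (V : lmodType R) (G : V -> R -> Prop) :
  (forall u, exists r, G u r) -> (forall u, exists b, forall r, G u r -> b <= r) ->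
  (forall u v r s, G u r -> G v s -> exists2 r', r' <= r + s & G (u + v) r') ->
  (forall u r s, 0 < s -> G u r -> exists2 r', r' <= s * r & G (s *: u) r') ->
  [/\ sublinear (fun u => inf [set r | G u r]),
    forall u r, G u r -> inf [set r | G u r] <= r &
    forall u b, (forall r, G u r -> b <= r) -> b <= inf [set r | G u r]].
Proof.
move=> G0 Gb GD GZ.
have inf_le u r : G u r -> inf [set r | G u r] <= r.
  by move=> Gr; apply: ge_inf => //; have [b hb] := Gb u; exists b.
have inf_ge u b : (forall r, G u r -> b <= r) -> b <= inf [set r | G u r].
  by move=> h; apply: lb_le_inf => //; have [r Gr] := G0 u; exists r.
split=> //; split=> [u v|s u s0].
  rewrite -lerBlDr; apply: (inf_ge) => r Gr; rewrite lerBlDr -lerBlDl.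
  apply: (inf_ge) => t Gt; rewrite lerBlDl.
  by have [r' hr' /inf_le h] := GD _ _ _ _ Gr Gt; apply: le_trans hr'.
rewrite -ler_pdivrMl//; apply: (inf_ge) => r Gr; rewrite ler_pdivrMl//.
by have [r' hr' /inf_le h] := GZ _ _ _ s0 Gr; apply: le_trans hr'.
Qed.

(** q u is the infimum of p (u + t e) - t p e over t >= 0. Taking t = 0 gives q <= p, and t = 1 at -
    e gives q (- e) <= - p e <= - q e: q is linear along e. *)
Lemma sublinear_straighten (R : realType) (V : lmodType R) (p : V -> R) (e : V) :
  sublinear p -> exists q : V -> R,
    [/\ sublinear q, forall u, q u <= p u & q (- e) <= - q e].
Proof.
move=> ps; have [pD pZ] := ps.
pose G u r := exists2 t : R, 0 <= t & r = p (u + t *: e) - t * p e.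
have pe t : 0 <= t -> p (t *: e) <= t * p e.
  rewrite le_eqVlt => /predU1P[<-|]; last exact: pZ.
  by rewrite scale0r mul0r sublinear0.
have pe' t : 0 <= t -> t * p e <= p (t *: e).
  rewrite le_eqVlt => /predU1P[<-|t0]; first by rewrite scale0r mul0r sublinear0.
  have := pZ t^-1 (t *: e); rewrite scalerA mulVf ?gt_eqF// scale1r invr_gt0.
  by move=> /(_ t0); rewrite ler_pdivlMl.
have [||||qs q_le le_q] := @sublinear_inf R V G.
- by move=> u; exists (p (u + 0 *: e) - 0 * p e), 0.
(* Lower bound from t p e <= p (t e) <= p (u + t e) + p (- u). *)
- move=> u; exists (- p (- u)) => _ [t t0 ->].
  have := pD (u + t *: e) (- u); rewrite addrAC subrr add0r.
  by have := pe' t t0; lra.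
- move=> u v _ _ [t t0 ->] [s s0 ->].
  exists (p (u + v + (t + s) *: e) - (t + s) * p e).
    have := pD (u + t *: e) (v + s *: e); rewrite addrACA -scalerDl; lra.
  by exists (t + s) => //; rewrite addr_ge0.
- move=> u _ s s0 [t t0 ->].
  exists (p (s *: u + (s * t) *: e) - (s * t) * p e).
    have := pZ s (u + t *: e) s0; rewrite scalerDr scalerA; lra.
  by exists (s * t) => //; rewrite mulr_ge0// ltW.
exists (fun u => inf [set r | G u r]); split=> //.
  by move=> u; apply: q_le; exists 0 => //; rewrite scale0r addr0 mul0r subr0.
apply: (@le_trans _ _ (- p e)).
  apply: q_le; exists 1 => //.
  by rewrite scale1r addNr sublinear0// mul1r sub0r.
by rewrite lerN2; apply: q_le; exists 0 => //; rewrite scale0r addr0 mul0r subr0.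
Qed.

(** p is straightened along each basis vector in turn; linearity along earlier ones survives because
    a sublinear minorant of q inherits q (- e) <= - q e. *)
Lemma hahn_banach_rV (R : realType) (n : nat) (p : 'rV[R]_n -> R) :
  sublinear p -> exists c : 'I_n -> R, forall u : 'rV[R]_n,
    \sum_i u 0 i * c i <= p u.
Proof.
move=> ps.
have [q [[qD qZ] qp qe]] : exists q : 'rV[R]_n -> R,
  [/\ sublinear q, forall u, q u <= p u &
    forall i, i \in enum 'I_n -> q (- delta_mx 0 i) <= - q (delta_mx 0 i)].
  elim: (enum 'I_n) => [|i s [q [qs qp qe]]]; first by exists p; split.
  have [q' [q's q'q q'e]] := sublinear_straighten (delta_mx 0 i) qs.
  exists q'; split=> // [u|j]; first exact: le_trans (q'q u) (qp u).
  rewrite inE => /predU1P[->//|/qe qj].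
  have := q'q (- delta_mx 0 j); have := q'q (delta_mx 0 j).
  have := q's.1 (delta_mx 0 j) (- delta_mx 0 j); rewrite subrr sublinear0//.
  lra.
have q0 : q 0 = 0 by apply: sublinear0.
have {}qe i : q (- delta_mx 0 i) <= - q (delta_mx 0 i) by apply: qe;
  rewrite mem_enum.
exists (fun i => q (delta_mx 0 i)) => u; apply: le_trans (qp u).
(* Combined with 0 <= q u + q (- u), this bounds the linear form at u by q u. *)
have qN : q (- u) <= - \sum_i u 0 i * q (delta_mx 0 i).
  rewrite {1}[u]row_sum_delta -!sumrN.
  elim/big_ind2: _ => [|x1 x2 y1 y2 h1 h2|i _]; first by rewrite q0.
    by apply: le_trans (qD _ _) _; exact: lerD.
  have [ui|ui|->] := ltgtP (u 0 i) 0.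
  - have := qZ (- u 0 i) (delta_mx 0 i) ltac:(lra).
    by rewrite scaleNr mulNr.
  - have := qZ (u 0 i) (- delta_mx 0 i) ui; rewrite scalerN => h.
    by apply: le_trans h _; rewrite -mulrN ler_wpM2l// ltW.
  - by rewrite scale0r oppr0 mul0r oppr0 q0.
by have := qD u (- u); rewrite subrr q0; lra.
Qed.

(** [V] is general so as to cover moment vectors and, with [R^o], real integrals. *)
Definition atoms_moment (R : realType) (X : Type) (V : lmodType R)
  (phi : X -> V) (l : seq (R * X)) : V :=
  \sum_(a <- l) a.1 *: phi a.2.

Definition atoms_ge0 (R : realType) (X : Type) (l : seq (R * X)) : Prop :=
  all (fun a => 0 <= a.1) l.

(* With [p u] the infimum of [t * v - nu h] over [t >= 0] and atomic measures
   [nu] of moment [t *: m - u], a linear minorant of [p] is a dual solution: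
   evaluate it at [- phi x] and at [m]. *)
Lemma moment_duality (R : realType) (X : Type) (n : nat) (phi : X -> 'rV[R]_n)
    (h : X -> R) (m : 'rV[R]_n) (v : R) :
  (forall u, exists t l,
    [/\ 0 < t, atoms_ge0 l & atoms_moment phi l = t *: m - u]) ->
  (forall l, atoms_ge0 l -> atoms_moment phi l = m ->
     atoms_moment (h : X -> R^o) l <= v) ->
  exists c : 'I_n -> R, (forall x, h x <= \sum_i phi x 0 i * c i) /\
    \sum_i m 0 i * c i <= v.
Proof.
move=> hint hv.
pose scale (s : R) (l : seq (R * X)) := [seq (s * a.1, a.2) | a <- l].
have momD (V : lmodType R) (f : X -> V) l1 l2 :
    atoms_moment f (l1 ++ l2) = atoms_moment f l1 + atoms_moment f l2.
  by rewrite /atoms_moment big_cat.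
have momZ (V : lmodType R) (f : X -> V) s l :
    atoms_moment f (scale s l) = s *: atoms_moment f l.
  rewrite /atoms_moment big_map scaler_sumr; apply: eq_bigr => a _.
  by rewrite scalerA.
have scale_ge0 s l : 0 <= s -> atoms_ge0 l -> atoms_ge0 (scale s l).
  by move=> s0; elim: l => //= a l IH /andP[a0 /IH lge0];
    rewrite /atoms_ge0/= mulr_ge0.
have cat_ge0 (l1 l2 : seq (R * X)) : atoms_ge0 l1 -> atoms_ge0 l2 ->
  atoms_ge0 (l1 ++ l2).
  by rewrite /atoms_ge0 all_cat => -> ->.
pose val (l : seq (R * X)) : R := atoms_moment (h : X -> R^o) l.
have hvt t l : 0 < t -> atoms_ge0 l -> atoms_moment phi l = t *: m ->
    val l <= t * v.
  move=> t0 l0 lm; have := hv (scale t^-1 l).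
  rewrite !momZ lm scalerA mulVf ?gt_eqF// scale1r => /(_ _ erefl).
  rewrite -ler_pdivrMl//; apply; apply: scale_ge0 => //.
  by rewrite invr_ge0 ltW.
pose G u r := exists t l,
  [/\ 0 <= t, atoms_ge0 l, atoms_moment phi l = t *: m - u & r = t * v - val l].
have [||||/hahn_banach_rV[c hc] p_le _] := @sublinear_inf R 'rV[R]_n G.
(* The interior hypothesis makes the infimum finite: at u it supplies a value; at - u it supplies a
   measure which, added to one of moment s m - u, gives a multiple of m, hence a lower bound. *)
- move=> u; have [t [l [t0 l0 lm]]] := hint u.
  by exists (t * v - val l), t, l; split=> //; exact: ltW.
- move=> u; have [t [l [t0 l0 lm]]] := hint (- u).
  exists (val l - t * v) => _ [s [k [s0 k0 km ->]]].
  have := hvt (s + t) (k ++ l); rewrite /val !momD km lm.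
  rewrite opprK addrACA addNr addr0 -scalerDl => /(_ _ _ erefl) H.
  by have := H ltac:(lra) (cat_ge0 _ _ k0 l0);
    rewrite -/(val l) -/(val k) mulrDl; lra.
- move=> u w _ _ [s [k [s0 k0 km ->]]] [t [l [t0 l0 lm ->]]].
  exists ((s + t) * v - val (k ++ l)); first
    by rewrite /val momD mulrDl -/(val l) -/(val k); lra.
  exists (s + t), (k ++ l); split=> //; [exact: addr_ge0|exact: cat_ge0|].
  by rewrite momD km lm scalerDl opprD addrACA.
- move=> u _ s s0 [t [l [t0 l0 lm ->]]].
  exists (s * t * v - val (scale s l)).
    by rewrite /val momZ -/(val l) mulrBr mulrA lexx.
  exists (s * t), (scale s l); split=> //; [by rewrite mulr_ge0// ltW| |].
    by apply: scale_ge0 => //; exact: ltW.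
  by rewrite momZ lm scalerBr scalerA.
exists c; split=> [x|].
  have := le_trans (hc (- phi x)) (p_le (- phi x) (- h x) _).
  have -> : \sum_i (- phi x) 0 i * c i = - \sum_i phi x 0 i * c i.
    by rewrite -sumrN; apply: eq_bigr => i _; rewrite mxE mulNr.
  rewrite lerN2; apply; exists 0, [:: (1, x)]; split=> //.
  - by rewrite /atoms_ge0/= ler01.
  - by rewrite /atoms_moment big_seq1 scale1r scale0r sub0r opprK.
  - by rewrite /val /atoms_moment big_seq1 scale1r mul0r sub0r.
have := le_trans (hc m) (p_le m v _); apply; exists 1, [::]; split=> //.
  by rewrite /atoms_moment big_nil scale1r subrr.
by rewrite /val /atoms_moment big_nil mul1r subr0.
Qed.

(** * Moments of the sum and of the squared norm *)

Definition nonneg_vec (R : realType) (T : nat) : Type :=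
  {x : 'I_T -> R | forall i, 0 <= x i}.

Definition stats (R : realType) (T : nat) (x : nonneg_vec R T) : 'rV[R]_4 :=
  \row_(k < 4) nth 0 [:: 1; \sum_i sval x i; \sum_i sval x i ^+ 2;
    (\sum_i sval x i) ^+ 2] k.

(* Three atoms suffice: the origin, a constant vector and a multiple of a unit
   vector, the last two having the same coordinate sum [d / b]. *)
Lemma stats_cone (R : realType) (T : nat) (a b c d : R) (u : 'rV[R]_4) :
  (2 <= T)%N -> 0 < b -> 0 < d -> b ^+ 2 <= a * d -> d / T%:R <= c -> c <= d ->
  u = \row_(k < 4) nth 0 [:: a; b; c; d] k ->
  exists2 l, atoms_ge0 l & atoms_moment (@stats R T) l = u.
Proof.
move=> T2 b0 d0 bad dc cd ->.
have n1 : 1 < T%:R :> R by rewrite ltr1n.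
set n : R := T%:R in dc n1 *.
have s0 : 0 <= d / b by rewrite divr_ge0// ltW.
have sn0 : 0 <= d / b / n by rewrite divr_ge0//; lra.
have i0 : 'I_T := Ordinal (ltnW T2).
(* Share of the constant vector, solving d * (eta / n + 1 - eta) = c. *)
pose eta := (d - c) * n / (d * (n - 1)).
have den0 : 0 < d * (n - 1) by rewrite mulr_gt0//; lra.
have eta0 : 0 <= eta by rewrite divr_ge0 ?mulr_ge0//; lra.
have eta1 : eta <= 1.
  rewrite ler_pdivrMr// mul1r.
  have : d / n * n <= c * n by rewrite ler_wpM2r//; lra.
  by rewrite divfK ?gt_eqF//; lra.
have bd0 : 0 <= b ^+ 2 / d by rewrite divr_ge0 ?sqr_ge0// ltW.
have dn0 : d != 0 by rewrite gt_eqF.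
have bn0 : b != 0 by rewrite gt_eqF.
have nn0 : n != 0 by rewrite gt_eqF//; lra.
have nn1 : n - 1 != 0 by rewrite gt_eqF//; lra.
have sx2 : \sum_(i < T) d / b / n = d / b.
  by rewrite sumr_const card_ord -[LHS]mulr_natr divfK.
have sx2' : \sum_(i < T) (d / b / n) ^+ 2 = (d / b) ^+ 2 / n.
  by rewrite sumr_const card_ord -[LHS]mulr_natr -/n; field; rewrite bn0 nn0.
have sx3 : \sum_(i < T) (i == i0)%:R * (d / b) = d / b.
  by rewrite (bigD1 i0)//= eqxx mul1r big1 ?addr0// => i /negbTE->; rewrite mul0r.
have sx3' : \sum_(i < T) ((i == i0)%:R * (d / b)) ^+ 2 = (d / b) ^+ 2.
  by rewrite (bigD1 i0)//= eqxx mul1r big1 ?addr0// => i /negbTE->;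
    rewrite mul0r expr0n.
have z1 : \sum_(i < T) (0 : R) = 0 by rewrite big1.
have z2 : \sum_(i < T) (0 : R) ^+ 2 = 0 by rewrite big1// => i _; rewrite expr0n.
have eta1' : 0 <= 1 - eta by lra.
have x1 : forall i : 'I_T, 0 <= (0 : R) by [].
have x2 : forall i : 'I_T, 0 <= d / b / n by [].
have x3 (i : 'I_T) : 0 <= (i == i0)%:R * (d / b) by rewrite mulr_ge0.
(* Weight b^2 / d at coordinate sum d / b yields the moments b and d; the origin takes the remaining
   mass. *)
exists [:: (a - b ^+ 2 / d, exist _ _ x1); (b ^+ 2 / d * eta, exist _ _ x2);
        (b ^+ 2 / d * (1 - eta), exist _ _ x3)].
  apply/and4P; split=> //; last 2 first.
  - exact: mulr_ge0.
  - exact: mulr_ge0.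
  by rewrite /= subr_ge0 ler_pdivrMr.
apply/rowP => k; rewrite /atoms_moment !big_cons big_nil !mxE/=
  sx2 sx2' sx3 sx3' z1 z2.
by case: k => [[|[|[|[|k]]]] kP]//=; rewrite /eta; field;
  rewrite ?dn0 ?bn0 ?nn0 ?nn1.
Qed.

(** The inequalities on m are strict, so t m - u satisfies the conditions of [stats_cone] for large
    t. *)
Lemma stats_interior (R : realType) (T : nat) (m1 m2 m3 : R) (u : 'rV[R]_4) :
  (2 <= T)%N -> 0 < m1 -> m1 ^+ 2 < m3 -> m3 / T%:R < m2 -> m2 < m3 ->
  exists t l, [/\ 0 < t, atoms_ge0 l & atoms_moment (@stats R T) l =
    t *: (\row_(k < 4) nth 0 [:: 1; m1; m2; m3] k) - u].
Proof.
move=> T2 m10 m1m3 m32 m23.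
set u0 := u 0 (inord 0); set u1 := u 0 (inord 1).
set u2 := u 0 (inord 2); set u3 := u 0 (inord 3).
have big (k v : R) : 0 < k -> \forall t \near +oo, v < t * k.
  move=> k0; near=> t; rewrite -ltr_pdivrMr//; near: t.
  by apply: nbhs_pinfty_gt; exact: num_real.
(* For t m - u the condition b^2 <= a d reads t B - C <= t^2 D, with D > 0. *)
pose D := m3 - m1 ^+ 2; pose B := u3 + u0 * m3 - 2 * m1 * u1;
pose C := u0 * u3 - u1 ^+ 2.
have m30 : 0 < m3 by have := sqr_ge0 m1; lra.
near (pinfty_nbhs R) => t.
have t1 : 1 < t by near: t; apply: nbhs_pinfty_gt; exact: num_real.
have h1 : u1 < t * m1 by near: t; exact: big.
have h3 : u3 < t * m3 by near: t; exact: big.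
have h32 : u3 - u2 < t * (m3 - m2) by near: t; apply: big; lra.
have h23 : u2 - u3 / T%:R < t * (m2 - m3 / T%:R) by near: t; apply: big; lra.
have hq : `|B| + `|C| < t * D by near: t; apply: big; rewrite /D; lra.
have [||||||l l0 lE] :=
  @stats_cone R T (t - u0) (t * m1 - u1) (t * m2 - u2) (t * m3 - u3)
  (t *: (\row_(k < 4) nth 0 [:: 1; m1; m2; m3] k) - u) T2.
- lra.
- lra.
- have hB : B <= `|B| := ler_norm _.
  have hC : - C <= `|C| by rewrite lerNl; exact: lerNnormlW.
  have C0 := normr_ge0 C.
  have : t * (`|B| + `|C|) <= t * (t * D) by rewrite ler_wpM2l//; lra.
  have : t * B <= t * `|B| by rewrite ler_wpM2l//; lra.
  have : `|C| <= t * `|C| by rewrite ler_peMl//; lra.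
  rewrite /D /B /C in hB hC *; lra.
- have Tn0 : 0 < T%:R :> R by rewrite ltr0n; lia.
  rewrite mulrBl; lra.
- lra.
- apply/rowP => k; rewrite !mxE.
  case: k => [[|[|[|[|k]]]] kP]//=; rewrite ?mulr1; congr (_ - u 0 _);
    by apply/val_inj; rewrite /= inordK.
by exists t, l; split=> //; lra.
Unshelve. all: by end_near.
Qed.

(** * Symmetrization of atomic measures over coordinate permutations *)

Section symmetrize.
Variables (R : realType) (T : nat) (l : seq (R * nonneg_vec R T)).

Definition perm_vec (s : 'S_T) (x : nonneg_vec R T) : nonneg_vec R T :=
  exist (fun y : 'I_T -> R => forall i, 0 <= y i)
    (fun i => sval x (s i)) (fun i => svalP x (s i)).

Definition symmetrize : seq (R * nonneg_vec R T) :=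
  [seq (a.1 / #|{: 'S_T}|%:R, perm_vec s a.2) | a <- l, s <- enum {: 'S_T}].

Let E (f : ('I_T -> R) -> R) : R := \sum_(a <- symmetrize) a.1 * f (sval a.2).

Let EE f : E f = \sum_(a <- l) a.1 *
  ((\sum_(s : 'S_T) f (fun i => sval a.2 (s i))) / #|{: 'S_T}|%:R).
Proof.
rewrite /E /symmetrize big_allpairs_dep/=; apply: eq_bigr => a _.
rewrite big_enum/= mulr_suml mulr_sumr; apply: eq_bigr => s _.
by rewrite mulrAC mulrA.
Qed.

Lemma symmetrize_ge0 : atoms_ge0 l -> atoms_ge0 symmetrize.
Proof.
rewrite /symmetrize; elim: l => //= a k IH /andP[a0 /IH k0].
rewrite /atoms_ge0 all_cat; apply/andP; split; last exact: k0.
by rewrite all_map; elim: (enum _) => //= s r ->; rewrite andbT divr_ge0.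
Qed.

Lemma symmetrize_invariant (f : ('I_T -> R) -> R) :
  (forall x (s : 'S_T), f (fun i => x (s i)) = f x) ->
  \sum_(a <- symmetrize) a.1 * f (sval a.2) = \sum_(a <- l) a.1 * f (sval a.2).
Proof.
move=> hf; rewrite [LHS]EE; apply: eq_bigr => a _; congr (_ * _).
under eq_bigr do rewrite hf.
rewrite sumr_const -[X in X / _]mulr_natr mulfK// pnatr_eq0 -lt0n.
by apply/card_gt0P; exists 1%g.
Qed.

(** Left translation by t permutes the group over which the average is taken. *)
Lemma symmetrize_perm (f : ('I_T -> R) -> R) (t : 'S_T) :
  \sum_(a <- symmetrize) a.1 * f (fun i => sval a.2 (t i)) =
  \sum_(a <- symmetrize) a.1 * f (sval a.2).
Proof.
rewrite [RHS]EE [LHS](EE (fun x => f (fun i => x (t i))));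
  apply: eq_bigr => a _; congr (_ * (_ / _)).
rewrite [RHS](reindex_inj (mulgI t))/=; apply: eq_bigr => s _; congr f.
by apply/funext => i; rewrite permM.
Qed.

(** By transpositions all coordinates have the same integral, and their total is permutation
    invariant. *)
Lemma symmetrize_coord (g : R -> R) (i : 'I_T) :
  T%:R * \sum_(a <- symmetrize) a.1 * g (sval a.2 i) =
  \sum_(a <- l) a.1 * \sum_j g (sval a.2 j).
Proof.
transitivity (\sum_(a <- symmetrize) a.1 * \sum_j g (sval a.2 j)); last first.
  apply: (symmetrize_invariant (f := fun x => \sum_j g (x j))) => x s.
  by rewrite [RHS](reindex_inj (@perm_inj _ s)).
under [RHS]eq_bigr do rewrite mulr_sumr.
rewrite [RHS]exchange_big/=.
rewrite [RHS](eq_bigr (fun=> \sum_(a <- symmetrize) a.1 * g (sval a.2 i))).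
  by rewrite sumr_const card_ord mulr_natl.
move=> j _; rewrite -(symmetrize_perm (fun x => g (x j)) (tperm i j)).
by apply: eq_bigr => a _; rewrite tpermR.
Qed.

(** By transpositions all T (T - 1) off-diagonal products have the same integral; together they sum
    to S^2 - |x|^2. *)
Lemma symmetrize_prod (i j : 'I_T) : i != j ->
  T%:R * (T%:R - 1) * \sum_(a <- symmetrize) a.1 * (sval a.2 i * sval a.2 j) =
  \sum_(a <- l) a.1 * (\sum_k sval a.2 k) ^+ 2 -
  \sum_(a <- l) a.1 * \sum_k sval a.2 k ^+ 2.
Proof.
move=> ij; pose S (x : 'I_T -> R) := \sum_k x k.
have Sperm (x : 'I_T -> R) (s : 'S_T) : S (fun i => x (s i)) = S x.
  by rewrite /S [RHS](reindex_inj (@perm_inj _ s)).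
have rowE : (T%:R - 1) * \sum_(a <- symmetrize) a.1 * (sval a.2 i * sval a.2 j) =
    \sum_(a <- symmetrize) a.1 * (sval a.2 i * S (sval a.2)) -
    \sum_(a <- symmetrize) a.1 * sval a.2 i ^+ 2.
  have -> : \sum_(a <- symmetrize) a.1 * (sval a.2 i * S (sval a.2)) =
      \sum_k \sum_(a <- symmetrize) a.1 * (sval a.2 i * sval a.2 k).
    by rewrite exchange_big; apply: eq_bigr => a _ /=; rewrite -!mulr_sumr.
  have -> : \sum_(a <- symmetrize) a.1 * sval a.2 i ^+ 2 =
      \sum_(a <- symmetrize) a.1 * (sval a.2 i * sval a.2 i).
    by apply: eq_bigr => a _; rewrite expr2.
  rewrite (bigD1 i)//=
    addrAC subrr add0r [RHS](eq_bigr
      (fun=> \sum_(a <- symmetrize) a.1 * (sval a.2 i * sval a.2 j))).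
    rewrite sumr_const cardC1 card_ord -[RHS]mulr_natl -subn1 natrB//.
    exact: leq_ltn_trans (ltn_ord i).
  move=> k ki; rewrite -(symmetrize_perm (fun x => x i * x k) (tperm j k)).
  by apply: eq_bigr => a _; rewrite tpermR tpermD// eq_sym.
have colE : T%:R * \sum_(a <- symmetrize) a.1 * (sval a.2 i * S (sval a.2)) =
    \sum_(a <- l) a.1 * S (sval a.2) ^+ 2.
  rewrite -(symmetrize_invariant (f := fun x => S x ^+ 2)); last by move=> x s;
    rewrite Sperm.
  have -> : \sum_(a <- symmetrize) a.1 * S (sval a.2) ^+ 2 =
      \sum_k \sum_(a <- symmetrize) a.1 * (sval a.2 k * S (sval a.2)).
    by rewrite exchange_big; apply: eq_bigr => a _ /=;
      rewrite -mulr_sumr -mulr_suml expr2.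
  rewrite [RHS](eq_bigr
    (fun=> \sum_(a <- symmetrize) a.1 * (sval a.2 i * S (sval a.2)))).
    by rewrite sumr_const card_ord mulr_natl.
  move=> k _; rewrite -(symmetrize_perm (fun x => x k * S x) (tperm i k)).
  by apply: eq_bigr => a _; rewrite tpermR Sperm.
by rewrite -mulrA rowE mulrBr colE (symmetrize_coord (fun t => t ^+ 2)).
Qed.

End symmetrize.

(** * Discrete probabilities and weak duality *)

Lemma continuous_borel_measurable (R : realType) (T : nat) (f : 'cV[R]_T -> R) :
  continuous f -> measurable_fun [set: borel_cV R T] (f : borel_cV R T -> R).
Proof.
move=> cf; apply: (measurability _ (RGenOInfty.measurableE R)) => _ [_ [r ->] <-].
rewrite setTI; apply: sub_sigma_algebra.
by apply: open_comp => [x _|]; [exact: cf|exact: interval_open].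
Qed.

Lemma discrete_measure (R : realType) d (X : measurableType d) (l : seq (R * X)) :
  all (fun a => 0 <= a.1) l ->
  exists m : {measure set X -> \bar R},
    (forall A, m A = (\sum_(a <- l) a.1 * \1_A a.2)%:E) /\
    forall f : X -> \bar R, measurable_fun setT f -> (forall x, (0 <= f x)%E) ->
      (\int[m]_x f x = \sum_(a <- l) a.1%:E * f a.2)%E.
Proof.
elim: l => [_|a l IH /= /andP[a0 /IH[m [mE mI]]]].
  exists mzero; split=> [A|f mf f0]; first by rewrite big_nil.
  by rewrite big_nil integral_measure_zero.
exists (measure_add (mscale (NngNum a0) (\d_(a.2))) m); split=> [A|f mf f0].
  apply: etrans (measure_addE _ _ _) _; rewrite big_cons EFinD; congr (_ + _)%E;
    exact: mE.
rewrite ge0_integral_measure_add// mI// big_cons ge0_integral_mscale//.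
by rewrite integral_dirac// diracT mul1e.
Qed.

Lemma discrete_probability (R : realType) d (X : measurableType d)
  (l : seq (R * X)) :
  all (fun a => 0 <= a.1) l -> \sum_(a <- l) a.1 = 1 ->
  exists P : probability X R,
    (forall A, P A = (\sum_(a <- l) a.1 * \1_A a.2)%:E) /\
    forall f : X -> R, measurable_fun setT f ->
      'E_P[f]%E = (\sum_(a <- l) a.1 * f a.2)%:E.
Proof.
move=> l0 l1; have [m [mE mI]] := discrete_measure l0.
have mT : m setT = 1%E.
  by rewrite mE; congr (_%:E); rewrite -l1; apply: eq_bigr => a _;
    rewrite indicT mulr1.
have [x] : inhabited X.
  case: l l1 {l0 mE mI} => [|a l _]; last exact: (inhabits a.2).
  by rewrite big_nil => /esym/eqP; rewrite oner_eq0.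
(* The total mass is 1, so normalization leaves m unchanged; x is only the fallback point it asks
   for. *)
pose P : probability X R := mnormalize m \d_x.
have PE A : P A = m A.
  by rewrite /P/= /mnormalize mT onee_eq0/= invr1 mule1.
exists P; split=> [A|f mf]; first by rewrite PE mE.
have mfE : measurable_fun setT (EFin \o f) by exact/measurable_EFinP.
rewrite unlock; have -> : (\int[P]_x (f x)%:E = \int[m]_x (EFin \o f) x)%E.
  by apply: eq_measure_integral => A _ _; exact: PE.
rewrite integralE !mI//; [|exact: measurable_funeneg|exact: measurable_funepos].
have posE (g : X -> R) a : (a.1%:E * (EFin \o g)^\+ a.2)%E =
  (a.1 * Num.max (g a.2) 0)%:E.
  by rewrite funeposE/= -EFin_max.
have negE (g : X -> R) a : (a.1%:E * (EFin \o g)^\- a.2)%E =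
  (a.1 * Num.max (- g a.2) 0)%:E.
  by rewrite funenegE/= -EFin_max.
under eq_bigr do rewrite posE.
under [X in (_ - X)%E]eq_bigr do rewrite negE.
rewrite !sumEFin -EFinB -sumrB; congr (_%:E); apply: eq_bigr => a _.
by rewrite -mulrBr; congr (_ * _); rewrite !maxEle; do 2 case: ifP; lra.
Qed.

Section has_mean.
Local Open Scope ereal_scope.
Context d (X : measurableType d) (R : realType) (P : probability X R).

(** Integrability travels with the value because linearity of the expectation requires it. *)
Definition has_mean (f : X -> R) (v : R) : Prop :=
  P.-integrable setT (EFin \o f) /\ 'E_P[f] = v%:E.

(** The integral is finite only if those of the positive and negative parts both are. *)
Lemma has_mean_of (f : X -> R) (v : R) :
  measurable_fun setT f -> 'E_P[f] = v%:E -> has_mean f v.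
Proof.
move=> mf Ef; split=> //; apply/integrableP; split; first exact/measurable_EFinP.
by rewrite /= integral_fin_num_abs//; move: Ef; rewrite unlock => ->.
Qed.

Lemma has_mean_cst (k : R) : has_mean (cst k) k.
Proof. by apply: has_mean_of => //; exact: expectation_cst. Qed.

Lemma has_meanD (f g : X -> R) (v w : R) : has_mean f v -> has_mean g w ->
  has_mean (fun x => f x + g x)%R (v + w)%R.
Proof.
move=> [fi Ef] [gi Eg]; split.
  rewrite (_ : EFin \o _ = (EFin \o f) \+ (EFin \o g)); first exact: integrableD.
  by apply/funext => x /=; rewrite EFinD.
have := expectationD (P := P) (X := f) (Y := g).
by rewrite Ef Eg; apply; exact/Lfun1_integrable.
Qed.

Lemma has_meanZ (k : R) (f : X -> R) (v : R) : has_mean f v ->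
  has_mean (fun x => k * f x)%R (k * v)%R.
Proof.
move=> [fi Ef]; split.
  rewrite (_ : EFin \o _ = (fun x => k%:E * (EFin \o f) x));
    first exact: integrableZl.
  by apply/funext => x /=; rewrite EFinM.
rewrite EFinM -Ef -expectationZl; last exact/Lfun1_integrable.
by rewrite unlock; apply: eq_integral => x _ /=; rewrite mulrC.
Qed.

Lemma has_mean_sum n (f : 'I_n -> X -> R) (v : 'I_n -> R) :
  (forall i, has_mean (f i) (v i)) ->
  has_mean (fun x => \sum_i f i x)%R (\sum_i v i)%R.
Proof.
elim: n f v => [|n IH] f v h.
  rewrite big_ord0 (_ : (fun x => _) = cst 0%R); first exact: has_mean_cst.
  by apply/funext => x; rewrite big_ord0.
rewrite big_ord_recl (_ : (fun x => _) =
  (fun x => f ord0 x + \sum_i f (lift ord0 i) x)%R); last first.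
  by apply/funext => x; rewrite big_ord_recl.
by apply: has_meanD => //; apply: IH => i.
Qed.

Lemma has_mean_ae_le (A : set X) (N : set X) (f : X -> R) (v : R) :
  measurable A -> measurable N -> P N = 1 -> has_mean f v ->
  (forall x, N x -> (0 <= f x)%R /\ (A x -> (1 <= f x)%R)) -> P A <= v%:E.
Proof.
move=> mA mN PN [fi Ef] hf.
have mf : measurable_fun setT f.
  by apply/measurable_EFinP; exact: measurable_int fi.
have PNC : P (~` N) = 0 by rewrite probability_setC// PN subee.
have aeN (Q : X -> Prop) : (forall x, N x -> Q x) -> {ae P, forall x, Q x}.
  move=> hQ; exists (~` N); split=> //; first exact: measurableC.
  by move=> x /= nQ Nx; apply: nQ; exact: hQ.
(* |f| agrees with f almost surely and is nonnegative everywhere, so it can be compared with the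
   indicator. *)
have -> : v%:E = 'E_P[(fun x => `|f x|)%R].
  rewrite -Ef unlock; apply: ae_eq_integral => //.
  - exact/measurable_EFinP.
  - by apply/measurable_EFinP; exact: measurableT_comp.
  - by apply: aeN => x /hf[f0 _] _; rewrite ger0_norm.
rewrite -(expectation_indic P mA); apply: expectation_le => //.
- exact: measurableT_comp.
- apply: aeN => x /hf[f0 f1]; rewrite ger0_norm// indicE.
  by case: (boolP (x \in A)) => //; rewrite inE.
Qed.

End has_mean.

(** Weak duality: on the orthant, which has full mass, the quadratic dominates the indicator of the
    event, and its mean depends only on the prescribed moments. *)
Lemma ambiguity_le_dual (R : realType) (T : nat) (mu sigma rho gamma a b g1 g2 : R)
    (Pr : probability (borel_cV R T) R) : (2 <= T)%N ->
  ambiguity_set mu sigma rho Pr -> dual_feasible T gamma a b g1 g2 ->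
  (Pr [set x : 'cV[R]_T | (gamma <= \prod_(t < T) x t 0)%R] <=
   (a + T%:R * mu * b + T%:R * (mu ^+ 2 + sigma ^+ 2) * g1 +
    T%:R * (T%:R * mu ^+ 2 + sigma ^+ 2 + (T%:R - 1) * rho * sigma ^+ 2) *
      g2)%:E)%E.
Proof.
move=> T2 [PN Em Ec] hd.
have coordc t : continuous (fun x : 'cV[R]_T => x t 0) by exact: coord_continuous.
have hm t : has_mean Pr (fun x : 'cV[R]_T => x t 0) mu.
  apply: has_mean_of; first exact: continuous_borel_measurable.
  by rewrite Em /mean_vec mxE.
have hc s t : has_mean Pr (fun x : 'cV[R]_T => x s 0 * x t 0)
    (mu ^+ 2 + rho * sigma ^+ 2 + (s == t)%:R * ((1 - rho) * sigma ^+ 2)).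
  apply: has_mean_of.
    apply: continuous_borel_measurable => x.
    by apply: continuousM; exact: coordc.
  have := Ec s t; congr (_ = _).
    by congr ('E_Pr[_])%E; apply/funext => x; rewrite mxE big_ord1 mxE.
  rewrite /cov_mx /mean_vec !mxE !big_ord1 !mxE; congr (_%:E).
  by rewrite mulr1 mulr_natl; case: eqP => _; rewrite ?mulr1n ?mulr0n; ring.
have hL : has_mean Pr (fun x : 'cV[R]_T => moment_poly a b g1 g2 (fun t => x t 0))
   (a + b * \sum_(t < T) mu +
     g1 * \sum_(t < T) (mu ^+ 2 + rho * sigma ^+ 2 +
       (t == t)%:R * ((1 - rho) * sigma ^+ 2))
    + g2 * \sum_(s < T) \sum_(t < T)
      (mu ^+ 2 + rho * sigma ^+ 2 + (s == t)%:R * ((1 - rho) * sigma ^+ 2))).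
  rewrite /moment_poly; apply: has_meanD; first apply: has_meanD;
    first apply: has_meanD.
  - exact: has_mean_cst.
  - by apply: has_meanZ; exact: has_mean_sum.
  - by apply: has_meanZ; apply: has_mean_sum => t; exact: hc.
  - apply: has_meanZ; rewrite (_ : (fun x => _) =
      (fun x : 'cV[R]_T => \sum_(s < T) \sum_(t < T) x s 0 * x t 0)).
      by apply: has_mean_sum => s; apply: has_mean_sum => t; exact: hc.
    apply/funext => x; rewrite expr2 mulr_suml; apply: eq_bigr => s _.
    by rewrite mulr_sumr.
have mprod : measurable
  ([set x : 'cV[R]_T | gamma <= \prod_(t < T) x t 0] : set (borel_cV R T)).
  have mf : measurable_fun [set: borel_cV R T]
    (fun x : 'cV[R]_T => \prod_(t < T) x t 0).
    apply: continuous_borel_measurable; apply: continuous_big => [|t _];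
      [exact: mul_continuous|exact: coordc].
  have := mf measurableT `[gamma, +oo[%classic (measurable_itv _).
  rewrite setTI; congr measurable; apply/seteqP; split=> x /=;
    rewrite in_itv/= andbT//.
have mN : measurable
  ([set x : 'cV[R]_T | forall t, 0 <= x t 0] : set (borel_cV R T)).
  have -> : [set x : 'cV[R]_T | forall t, 0 <= x t 0] =
    \bigcap_(t in [set: 'I_T]) [set x : 'cV[R]_T | 0 <= x t 0].
    by apply/seteqP; split=> x /= h t; [move=> _|]; exact: h.
  apply: fin_bigcap_measurable => // t _.
  have mf : measurable_fun [set: borel_cV R T] (fun x : 'cV[R]_T => x t 0).
    exact: continuous_borel_measurable.
  have := mf measurableT `[0, +oo[%classic (measurable_itv _).
  rewrite setTI; congr measurable; apply/seteqP; split=> x /=;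
    rewrite in_itv/= andbT//.
apply: le_trans (has_mean_ae_le mprod mN PN hL _) _.
  by move=> x /= x0; exact: hd.
rewrite lee_fin le_eqVlt; apply/orP; left; apply/eqP.
have sum_cst (c : R) : \sum_(t < T) c = T%:R * c.
  by rewrite sumr_const card_ord mulr_natl.
have sum_delta (c e : R) (s : 'I_T) :
    \sum_(t < T) (c + (s == t)%:R * e) = T%:R * c + e.
  rewrite big_split/= sum_cst; congr (_ + _).
  rewrite (bigD1 s)//= eqxx mul1r big1 ?addr0// => t.
  by rewrite eq_sym => /negbTE->; rewrite mul0r.
under [X in _ + g2 * X]eq_bigr do rewrite sum_delta.
under [X in _ + g1 * X + _]eq_bigr do rewrite eqxx mul1r.
rewrite !sum_cst; ring.
Qed.

(** * Strong duality *)

(** Expectations of (1, S, |x|^2, S^2) under the moment conditions; they are the coefficients of the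
    objective. *)
Definition stats_target (R : realType) (T : nat) (mu sigma rho : R) : 'rV[R]_4 :=
  \row_(k < 4) nth 0 [:: 1; T%:R * mu; T%:R * (mu ^+ 2 + sigma ^+ 2);
    T%:R * (T%:R * mu ^+ 2 + sigma ^+ 2 + (T%:R - 1) * rho * sigma ^+ 2)] k.

Lemma sum_ord4 (R : nmodType) (f : 'I_4 -> R) :
  \sum_i f i = f (inord 0) + f (inord 1) + f (inord 2) + f (inord 3).
Proof.
rewrite !big_ord_recl big_ord0 addr0 !addrA.
by congr (f _ + f _ + f _ + f _); apply/val_inj; rewrite /= inordK.
Qed.

(** Symmetrization recovers the full mean vector and second-moment matrix from four moments and
    keeps the probability of the permutation-invariant event. *)
Lemma atoms_le_worst_case (R : realType) (T : nat) (mu sigma rho gamma : R)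
    (l : seq (R * nonneg_vec R T)) : (2 <= T)%N ->
  atoms_ge0 l -> atoms_moment (@stats R T) l = stats_target T mu sigma rho ->
  ((\sum_(a <- l) a.1 * (gamma <= \prod_i sval a.2 i)%R%:R)%:E <=
    worst_case_prob T mu sigma rho gamma)%E.
Proof.
move=> T2 l0 lm.
have n0 : T%:R != 0 :> R by rewrite pnatr_eq0 -lt0n ltnW.
have n1 : T%:R - 1 != 0 :> R.
  by rewrite subr_eq0 pnatr_eq1; apply/eqP; lia.
have coordE k (k4 : (k < 4)%N) : \sum_(a <- l) a.1 * stats a.2 0 (Ordinal k4) =
    stats_target T mu sigma rho 0 (Ordinal k4).
  by rewrite -lm /atoms_moment summxE; apply: eq_bigr => a _; rewrite !mxE.
have m0 : \sum_(a <- l) a.1 * 1 = 1.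
  by have := coordE 0%N isT; rewrite mxE/= => H; rewrite -[RHS]H;
    apply: eq_bigr => a _; rewrite mxE.
have m1 : \sum_(a <- l) a.1 * \sum_i sval a.2 i = T%:R * mu.
  by have := coordE 1%N isT; rewrite mxE/= => H; rewrite -[RHS]H;
    apply: eq_bigr => a _; rewrite mxE.
have m2 : \sum_(a <- l) a.1 * \sum_i sval a.2 i ^+ 2 =
  T%:R * (mu ^+ 2 + sigma ^+ 2).
  by have := coordE 2%N isT; rewrite mxE/= => H; rewrite -[RHS]H;
    apply: eq_bigr => a _; rewrite mxE.
have m3 : \sum_(a <- l) a.1 * (\sum_i sval a.2 i) ^+ 2 =
    T%:R * (T%:R * mu ^+ 2 + sigma ^+ 2 + (T%:R - 1) * rho * sigma ^+ 2).
  by have := coordE 3%N isT; rewrite mxE/= => H; rewrite -[RHS]H;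
    apply: eq_bigr => a _; rewrite mxE.
pose k : seq (R * borel_cV R T) :=
  [seq (a.1, \col_i sval a.2 i : 'cV[R]_T) | a <- symmetrize l].
have sumE (f : 'cV[R]_T -> R) : \sum_(a <- k) a.1 * f a.2 =
    \sum_(a <- symmetrize l) a.1 * f (\col_i sval a.2 i) by rewrite big_map.
have k0 : all (fun a => 0 <= a.1) k by rewrite all_map; exact: symmetrize_ge0.
have k1 : \sum_(a <- k) a.1 = 1.
  rewrite big_map -[RHS]m0 -(symmetrize_invariant l (f := fun=> 1))//.
  by apply: eq_bigr => a _; rewrite mulr1.
have [P [PE EPE]] := discrete_probability k0 k1.
have coordc t : continuous (fun x : 'cV[R]_T => x t 0) by exact: coord_continuous.
apply: ereal_sup_ubound; exists P; last first.
  rewrite PE; congr (_%:E).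
  rewrite (sumE (\1_[set x : 'cV[R]_T | gamma <= \prod_(t < T) x t 0])).
  rewrite -(symmetrize_invariant l (f := fun x => (gamma <= \prod_i x i)%R%:R)).
    apply: eq_bigr => a _; congr (_ * _); rewrite indicE; congr (nat_of_bool _)%:R.
    have -> : (\prod_i sval a.2 i) = \prod_(t < T) (\col_i sval a.2 i) t 0.
      by apply: eq_bigr => t _; rewrite mxE.
    by apply/idP/idP; rewrite inE.
  by move=> x s; congr ((_ <= _)%R%:R); rewrite [RHS](reindex_inj (@perm_inj _ s)).
split.
- rewrite PE; congr (_%:E); rewrite -[RHS]k1 !big_map; apply: eq_bigr => a _.
  rewrite /= indicE mem_set ?mulr1//= => t.
  by rewrite mxE; exact: (svalP a.2).
- move=> t; rewrite EPE; last exact: continuous_borel_measurable.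
  rewrite (sumE (fun x => x t 0)) /mean_vec mxE; congr (_%:E).
  apply: (mulfI n0); rewrite -m1 -(symmetrize_coord l id t); congr (_ * _).
  by apply: eq_bigr => a _; rewrite mxE.
- move=> s t.
  have -> : (fun x : 'cV[R]_T => (x *m x^T) s t) =
    (fun x : 'cV[R]_T => x s 0 * x t 0).
    by apply/funext => x; rewrite mxE big_ord1 mxE.
  rewrite EPE; last first.
    by apply: continuous_borel_measurable => x; apply: continuousM; exact: coordc.
  rewrite (sumE (fun x => x s 0 * x t 0)); congr (_%:E).
  under eq_bigr do rewrite !mxE.
  rewrite /cov_mx /mean_vec !mxE !big_ord1 !mxE.
  have [<-|st] := eqVneq s t.
    apply: (mulfI n0).
    rewrite (eq_bigr (fun a => a.1 * sval a.2 s ^+ 2)); last by move=> a _;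
      rewrite expr2.
    by rewrite (symmetrize_coord l (fun t => t ^+ 2)) m2 mulr1n; ring.
  apply: (mulfI (mulf_neq0 n0 n1)).
  by rewrite symmetrize_prod// m2 m3 mulr0n; ring.
Qed.

(** Weak duality gives one inequality. For the other, moment duality at the worst-case value yields
    a feasible point whose objective is no larger. *)
Lemma worst_case_eq_sdp (R : realType) (T : nat) (mu sigma rho gamma : R) :
  (2 <= T)%N -> 0 < mu -> 0 < sigma -> - (1 / (T%:R - 1)) < rho -> rho < 1 ->
  0 < mu ^+ 2 + rho * sigma ^+ 2 -> 0 < gamma ->
  worst_case_prob T mu sigma rho gamma =
  sdp_value mu sigma rho (@sdp_feasible_any R T gamma).
Proof.
move=> T2 mu0 sigma0 rho_lb rho_ub hpos g0.
have weak a b g1 g2 : dual_feasible T gamma a b g1 g2 ->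
    (worst_case_prob T mu sigma rho gamma <=
     (a + T%:R * mu * b + T%:R * (mu ^+ 2 + sigma ^+ 2) * g1 +
      T%:R * (T%:R * mu ^+ 2 + sigma ^+ 2 + (T%:R - 1) * rho * sigma ^+ 2) *
        g2)%:E)%E.
  move=> hd; apply: ge_ereal_sup => _ [Pr hPr <-].
  exact: ambiguity_le_dual hd.
apply/eqP; rewrite eq_le; apply/andP; split.
  apply: le_ereal_inf_tmp => _ [v hv <-].
  exact: weak (sdp_feasible_dual T2 g0 hv).
have n1 : 1 < T%:R :> R by rewrite ltr1n.
set n : R := T%:R in rho_lb weak n1 *.
have s20 : 0 < sigma ^+ 2 by rewrite exprn_gt0.
have rho_n : 0 < 1 + (n - 1) * rho.
  have : (n - 1) * - (1 / (n - 1)) < (n - 1) * rho by rewrite ltr_pM2l//; lra.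
  by rewrite mulrN mulrCA mulfV ?mulr1; lra.
pose m1 := n * mu; pose m2 := n * (mu ^+ 2 + sigma ^+ 2).
pose m3 := n * (n * mu ^+ 2 + sigma ^+ 2 + (n - 1) * rho * sigma ^+ 2).
have n0 : 0 < n by lra.
have m10 : 0 < m1 by rewrite mulr_gt0.
(* Interior position: [m13] rests on the lower bound on rho, [m32] on rho < 1, [m23] on mu^2 + rho
   sigma^2 > 0. *)
have m13 : m1 ^+ 2 < m3.
  have : 0 < n * (sigma ^+ 2 * (1 + (n - 1) * rho)) by rewrite !mulr_gt0.
  rewrite /m1 /m3; lra.
have m30 : 0 < m3 by have := sqr_ge0 m1; lra.
have m32 : m3 / n < m2.
  rewrite /m3 mulrAC divff ?gt_eqF// mul1r /m2.
  have : 0 < (n - 1) * (sigma ^+ 2 * (1 - rho)) by rewrite !mulr_gt0//; lra.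
  lra.
have m23 : m2 < m3.
  have : 0 < n * ((n - 1) * (mu ^+ 2 + rho * sigma ^+ 2))
    by rewrite !mulr_gt0//; lra.
  rewrite /m2 /m3; lra.
have tE : stats_target T mu sigma rho = \row_(k < 4) nth 0 [:: 1; m1; m2; m3] k
  by [].
pose h (x : nonneg_vec R T) : R := (gamma <= \prod_i sval x i)%R%:R.
have [||||||l l0 lE] := @stats_cone R T 1 m1 m2 m3 (stats_target T mu sigma rho) T2.
- exact: m10.
- exact: m30.
- by rewrite mul1r ltW.
- exact: ltW.
- exact: ltW.
- exact: tE.
(* Bounded below by an atomic measure with the target moments, above by the constant dual solution
   1. *)
have fin : worst_case_prob T mu sigma rho gamma \is a fin_num.
  apply/fin_numPlt; apply/andP; split.
    by apply: lt_le_trans (atoms_le_worst_case gamma T2 l0 lE); exact: ltNyr.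
  apply: le_lt_trans (weak 1 0 0 0 _) _; last exact: ltry.
  by move=> x x0; rewrite /moment_poly !mul0r !addr0.
have [u|k k0 kE|c [hc mc]] := @moment_duality R _ 4 (@stats R T) h
    (stats_target T mu sigma rho) (fine (worst_case_prob T mu sigma rho gamma)).
- by rewrite tE; exact: stats_interior.
- by rewrite -lee_fin fineK//; exact: atoms_le_worst_case.
have [|v hv [aE bE g1E g2E]] := @dual_feasible_sdp R T gamma
    (c (inord 0)) (c (inord 1)) (c (inord 2)) (c (inord 3)) T2 g0.
  move=> x x0; have := hc (exist _ x x0); rewrite sum_ord4 !mxE !inordK//=.
  have -> : 1 * c (inord 0) + (\sum_i x i) * c (inord 1) +
      (\sum_i x i ^+ 2) * c (inord 2) + (\sum_i x i) ^+ 2 * c (inord 3) =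
      moment_poly (c (inord 0)) (c (inord 1)) (c (inord 2)) (c (inord 3)) x.
    by rewrite /moment_poly; ring.
  rewrite /h/= => hx; split; first by apply: le_trans hx.
  by move=> xp; move: hx; rewrite xp.
apply: (@le_trans _ _ (sdp_objective mu sigma rho v)%:E).
  by apply: ereal_inf_lbound; exists v.
rewrite -[leRHS]fineK// lee_fin; apply: le_trans mc.
rewrite /sdp_objective aE bE g1E g2E sum_ord4 !mxE !inordK//= -/n.
by rewrite le_eqVlt; apply/orP; left; apply/eqP; ring.
Qed.

Theorem theorem4p1 (R : realType) (T : nat) (mu sigma rho gamma : R)
    (hT : (2 <= T)%N) (hmu : 0 < mu) (hsigma : 0 < sigma)
    (hrho_lb : - (1 / (T%:R - 1)) < rho) (hrho_ub : rho < 1)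
    (hpos : 0 < mu ^+ 2 + rho * sigma ^+ 2) (hgamma : 0 < gamma) :
  ((3 <= T)%N ->
     worst_case_prob T mu sigma rho gamma =
     sdp_value mu sigma rho (@sdp_feasible R T gamma)) /\
  (T = 2%N ->
     worst_case_prob T mu sigma rho gamma =
     sdp_value mu sigma rho (@sdp_feasible_merged R T gamma)).
Proof.
have := worst_case_eq_sdp hT hmu hsigma hrho_lb hrho_ub hpos hgamma.
rewrite /sdp_feasible_any => main; split=> [T3|T2]; rewrite main.
  by rewrite gtn_eqF.
by rewrite T2.
Qed.
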